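(* Let $d\geq4$. There exists a constant $C=C(d)>0$ depending only on $d$ such that the adjoint Radon transform $\mathcal{R}^*$ satisfies the following. (a) Let $b>a>0$ satisfy $b/a<\frac{d^2-2d-1}{2(d-1)}$, and let $G\in L^2(\mathbb{R}\times\mathbb{S}^{d-1})$ be supported in $[a,b]\times\mathbb{S}^{d-1}$. Then for every $R>0$ $$\int_{|x|>R}|(\mathcal{R}^*G)(x)|^{2d}\,dx\leq C\,\frac{(b-a)^d}{a\,(\max\{R,a\})^{d-1}}\,\|G\|_{L^2}^{2d}.$$ In particular, $$\int_{\mathbb{R}^d}|(\mathcal{R}^*G)(x)|^{2d}\,dx\leq C\,(b/a-1)^d\,\|G\|_{L^2}^{2d}.$$ (b) Let $b>0$ and let $G\in L^2(\mathbb{R}\times\mathbb{S}^{d-1})$ be supported in $[-b,b]\times\mathbb{S}^{d-1}$. Then for every $R\geq b$ $$\int_{|x|>R}|(\mathcal{R}^*G)(x)|^{2d}\,dx\leq C\,(b/R)^{d-1}\,\|G\|_{L^2}^{2d}.$$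
   Context: The adjoint Radon transform is the operator $$(\mathcal{R}^*G)(x)=\int_{\mathbb{S}^{d-1}}G(x\cdot\omega,\omega)\,d\omega,\qquad x\in\mathbb{R}^d,$$ where $d\omega$ is the standard surface measure on the unit sphere $\mathbb{S}^{d-1}\subset\mathbb{R}^d$; for $G\in L^2$ the formula is understood for almost every $x$. $\|G\|_{L^2}$ is the norm of $L^2(\mathbb{R}\times\mathbb{S}^{d-1})$ with respect to $ds\,d\omega$. *)

(* Defs.v *)
From HB Require Import structures.
From mathcomp Require Import all_boot all_order all_algebra.
From mathcomp Require Import all_classical all_reals all_analysis.
From mathcomp Require Import measurable_realfun.

Set Implicit Arguments.
Unset Strict Implicit.
Unset Printing Implicit Defensive.

Import Order.TTheory GRing.Theory Num.Theory.
Import numFieldNormedType.Exports.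

Local Open Scope classical_set_scope.
Local Open Scope ring_scope.

(* [measurableTypeR R] is [R] with its Borel sigma-algebra; it is the type on
   which [lebesgue_measure] is declared. *)
Notation euclidean R n := (n.-tuple (measurableTypeR R)).

Section euclidean_structure.
Context {R : realType} {n : nat}.
Implicit Types x y : euclidean R n.

Definition dotp x y : R := \sum_(i < n) (tnth x i : R) * (tnth y i : R).

Definition enorm x : R := Num.sqrt (dotp x x).

Definition direction x : euclidean R n :=
  [tuple (enorm x)^-1 * (tnth x i : R) | i < n].

Lemma enorm_ge0 x : 0 <= enorm x.
Proof. exact: sqrtr_ge0. Qed.

Lemma measurable_coord (i : 'I_n) :
  measurable_fun setT (fun x : euclidean R n => tnth x i : R).
Proof. exact: (@measurable_tnth _ (measurableTypeR R) n i). Qed.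

Lemma measurable_enorm : measurable_fun setT (enorm : euclidean R n -> R).
Proof.
have -> : enorm = (fun x => dotp x x `^ 2^-1).
  apply/funext => x; rewrite powR12_sqrt// /dotp.
  by apply: sumr_ge0 => i _; rewrite -expr2 sqr_ge0.
apply: (@measurableT_comp _ _ _ _ _ _ (fun r : R => r `^ 2^-1) _
  (fun x : euclidean R n => dotp x x)).
  exact: measurable_powR.
apply: measurable_sum => i.
by apply: measurable_funM; exact: measurable_coord.
Qed.

Lemma measurable_direction : measurable_fun setT direction.
Proof.
apply/measurable_fun_tnthP => i.
have -> : (@tnth n (measurableTypeR R))^~ i \o direction =
    (fun x : euclidean R n => enorm x `^ (-1) * (tnth x i : R)).
  apply/funext => x; rewrite /= tnth_mktuple.
  by rewrite powR_inv1// enorm_ge0.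
apply: measurable_funM; last exact: measurable_coord.
apply: (@measurableT_comp _ _ _ _ _ _ (fun r : R => r `^ (-1)) _ enorm).
  exact: measurable_powR.
exact: measurable_enorm.
Qed.

End euclidean_structure.

Lemma pushforward_sigma_additive d1 d2 (T1 : measurableType d1)
    (T2 : measurableType d2) (R : realType) (m : {measure set T1 -> \bar R})
    (f : T1 -> T2) :
  measurable_fun setT f -> semi_sigma_additive (pushforward m f).
Proof.
move=> mf; exact: (@measure_semi_sigma_additive _ _ _
  (measure_function_pushforward__canonical__measure_function_Measure m mf)).
Qed.

Section cons_measure.
Context {R : realType} {n : nat}.
Variable m : {sigma_finite_measure set (euclidean R n) -> \bar R}.

Definition cons_euclidean (p : measurableTypeR R * euclidean R n) :
  euclidean R n.+1 := [tuple of p.1 :: p.2].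

Definition uncons_euclidean (x : euclidean R n.+1) :
  measurableTypeR R * euclidean R n := (thead x, [tuple of behead x]).

Lemma cons_euclideanK : cancel cons_euclidean uncons_euclidean.
Proof. by case=> a x; congr pair; apply/val_inj. Qed.

Lemma measurable_cons_euclidean : measurable_fun setT cons_euclidean.
Proof. exact: measurable_cons. Qed.

Lemma measurable_uncons_euclidean : measurable_fun setT uncons_euclidean.
Proof.
apply: measurable_fun_pair; last exact: measurable_behead.
exact: (@measurable_tnth _ (measurableTypeR R) n.+1 ord0).
Qed.

Definition cons_measure : set (euclidean R n.+1) -> \bar R :=
  pushforward ((@lebesgue_measure R) \x m)%E cons_euclidean.

Let cons_measure0 : cons_measure set0 = 0%E.
Proof. by rewrite /cons_measure /pushforward preimage_set0 measure0. Qed.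

Let cons_measure_ge0 A : (0 <= cons_measure A)%E.
Proof. by rewrite /cons_measure /pushforward; exact: measure_ge0. Qed.

Let cons_measure_sigma_additive : semi_sigma_additive cons_measure.
Proof.
rewrite /cons_measure.
apply: pushforward_sigma_additive.
exact: measurable_cons_euclidean.
Qed.

HB.instance Definition _ := isMeasure.Build _ _ _ cons_measure
  cons_measure0 cons_measure_ge0 cons_measure_sigma_additive.

Lemma cons_measureX (A : set (measurableTypeR R)) (B : set (euclidean R n)) :
  measurable A -> measurable B ->
  cons_measure (uncons_euclidean @^-1` (A `*` B)) =
  (@lebesgue_measure R A * m B)%E.
Proof.
move=> mA mB; rewrite -product_measure1E//.
rewrite /cons_measure /pushforward -comp_preimage.
by rewrite (_ : _ \o _ = id)//; apply/funext => p; exact: cons_euclideanK.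
Qed.

Let cons_measure_sigma_finite : sigma_finite setT cons_measure.
Proof.
have /sigma_finiteP[F [TF ndF Foo]] := sigma_finiteT (@lebesgue_measure R).
have /sigma_finiteP[G [TG ndG Goo]] := sigma_finiteT m.
exists (fun k => uncons_euclidean @^-1` (F k `*` G k)).
  apply/esym; rewrite -subTset => x _.
  have [i _ Fi] : (\bigcup_k F k) (uncons_euclidean x).1 by rewrite -TF.
  have [j _ Gj] : (\bigcup_k G k) (uncons_euclidean x).2 by rewrite -TG.
  exists (maxn i j) => //; split.
    by move: Fi; exact/subsetPset/ndF/leq_maxl.
  by move: Gj; exact/subsetPset/ndG/leq_maxr.
move=> k; have [mF Fk] := Foo k; have [mG Gk] := Goo k; split.
  rewrite -[X in measurable X]setTI.
  by apply: measurable_uncons_euclidean => //; exact: measurableX.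
by rewrite cons_measureX// lte_mul_pinfty// ge0_fin_numE.
Qed.

HB.instance Definition _ := Measure_isSigmaFinite.Build _ _ _ cons_measure
  cons_measure_sigma_finite.

End cons_measure.

(* Lebesgue measure on R^n: the n-fold product of [lebesgue_measure]. *)
Fixpoint lebesgue_euclidean (R : realType) (n : nat) :
    {sigma_finite_measure set (euclidean R n) -> \bar R} :=
  match n with
  | 0 => [the {sigma_finite_measure set (euclidean R 0) -> \bar R} of
           dirac ([tuple] : euclidean R 0)]
  | n'.+1 => [the {sigma_finite_measure set (euclidean R n'.+1) -> \bar R} of
           cons_measure (lebesgue_euclidean R n')]
  end.

Lemma lebesgue_euclidean_cube (R : realType) (n : nat) :
  let cube := [set x : euclidean R n | forall i, `|tnth x i : R| <= 1] in
  measurable cube /\ (lebesgue_euclidean R n cube < +oo)%E.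
Proof.
elim: n => [|n [mcube cube_fin]] cube.
  rewrite (_ : cube = setT) /=; last by apply/seteqP; split=> x //= _ [].
  by split; [exact: measurableT|rewrite diracT ltry].
have -> : cube = uncons_euclidean @^-1` (`[-1, 1] `*`
    [set x : euclidean R n | forall i, `|tnth x i : R| <= 1]).
  apply/seteqP; split=> x /=; rewrite in_itv /=.
    move=> cx; split=> [|i]; first by rewrite -ler_norml; exact: cx.
    have -> : tnth [tuple of behead x] i = tnth x (lift ord0 i).
      by rewrite [in RHS](tuple_eta x) tnthS.
    exact: cx.
  rewrite -ler_norml => -[x0 xi] i; case: (unliftP ord0 i) => [j ->|->//].
  by have := xi j; rewrite [in X in _ -> X](tuple_eta x) tnthS.
split.
  rewrite -[X in measurable X]setTI.
  apply: measurable_uncons_euclidean => //.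
  by apply: measurableX => //; exact: (@measurable_itv R).
rewrite /= cons_measureX//.
apply: lte_mul_pinfty => //; rewrite lebesgue_measure_itv /=.
by case: ifP.
Qed.

Section surface_measure.
Context {R : realType} {n : nat}.
Local Notation lebesgue := (@lebesgue_euclidean R n).

Definition punctured_ball : set (euclidean R n) :=
  [set x | 0 < enorm x <= 1].

(* The surface measure of S^(n-1), as a measure on R^n that is carried by the
   unit sphere: polar coordinates give that a Borel part A of the sphere has
   area n times the volume of the cone {r w | 0 < r <= 1, w in A}. *)
Definition surface_measure (A : set (euclidean R n)) : \bar R :=
  (n%:R%:E * lebesgue (direction @^-1` A `&` punctured_ball))%E.

Lemma measurable_punctured_ball : measurable punctured_ball.
Proof.
rewrite (_ : punctured_ball = enorm @^-1` `]0, 1]); last first.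
  by apply/seteqP; split=> x /=; rewrite in_itv.
by rewrite -[X in measurable X]setTI; exact: measurable_enorm.
Qed.

Let surface_measure0 : surface_measure set0 = 0%E.
Proof.
by rewrite /surface_measure preimage_set0 set0I measure0 mule0.
Qed.

Let surface_measure_ge0 A : (0 <= surface_measure A)%E.
Proof. by apply: mule_ge0; [rewrite lee_fin|exact: measure_ge0]. Qed.

Let surface_measure_sigma_additive : semi_sigma_additive surface_measure.
Proof.
exact: (@measure_semi_sigma_additive _ _ _ (mscale
  (n%:R%:nng : {nonneg R})
  (measure_function_pushforward__canonical__measure_function_Measure
    (mrestr lebesgue measurable_punctured_ball) measurable_direction))).
Qed.

HB.instance Definition _ := isMeasure.Build _ _ _ surface_measure
  surface_measure0 surface_measure_ge0 surface_measure_sigma_additive.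

Let surface_measure_finite : fin_num_fun surface_measure.
Proof.
move=> A mA; rewrite ge0_fin_numE; last exact: measure_ge0.
rewrite /surface_measure; apply: lte_mul_pinfty => //.
have [mcube cube_fin] := lebesgue_euclidean_cube R n.
apply: (le_lt_trans _ cube_fin); apply: le_measure; rewrite ?inE//.
  apply: measurableI; last exact: measurable_punctured_ball.
  by rewrite -[X in measurable X]setTI; exact: measurable_direction.
move=> x [_ /andP[_ x1]] i; apply: le_trans x1.
rewrite /enorm -sqrtr_sqr ler_sqrt; last first.
  by apply: sumr_ge0 => j _; rewrite -expr2 sqr_ge0.
rewrite /dotp (bigD1 i)//= expr2 lerDl.
by apply: sumr_ge0 => j _; rewrite -expr2 sqr_ge0.
Qed.

HB.instance Definition _ := Measure_isFinite.Build _ _ _ surface_measure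
  surface_measure_finite.

Lemma surface_measure_carrier :
  surface_measure (~` [set x | enorm x = 1]) = 0%E.
Proof.
rewrite /surface_measure (_ : _ `&` _ = set0) ?measure0 ?mule0//.
apply/seteqP; split=> x //= [x1 /andP[x_gt0 _]]; apply: x1.
rewrite /enorm (_ : dotp _ _ = (enorm x) ^- 2 * dotp x x); last first.
  rewrite /dotp mulr_sumr; apply: eq_bigr => i _.
  by rewrite tnth_mktuple mulrACA -expr2 exprVn.
have -> : dotp x x = enorm x ^+ 2.
  rewrite sqr_sqrtr//; apply: sumr_ge0 => i _.
  by rewrite -expr2 sqr_ge0.
by rewrite mulVf ?sqrtr1// expf_neq0// gt_eqF.
Qed.

End surface_measure.
Arguments surface_measure : clear implicits.

(* The measure ds dw on R x S^(n-1). *)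
Notation cylinder_measure R n :=
  (@lebesgue_measure R \x surface_measure R n)%E.

(* In [\bar R], [+oo - +oo] is [-oo], so [`|adjoint_radon G x|] is [+oo] where
   the integral does not converge absolutely. *)
Definition adjoint_radon (R : realType) (n : nat)
    (G : measurableTypeR R * euclidean R n -> R) (x : euclidean R n) : \bar R :=
  (\int[surface_measure R n]_w (G (dotp x w, w))%:E)%E.

(* Main.v *)
From HB Require Import structures.
Require Import Defs.
From mathcomp Require Import all_boot all_order all_algebra.
From mathcomp Require Import all_classical all_reals all_analysis.
From mathcomp Require Import measurable_realfun.
From mathcomp Require Import lra ring.

Import Order.TTheory GRing.Theory Num.Theory.
Import numFieldNormedType.Exports.

Local Open Scope classical_set_scope.
Local Open Scope ring_scope.

Set Implicit Arguments.
Unset Strict Implicit.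
Unset Printing Implicit Defensive.

(** The proof is a T T-star argument for a regularised adjoint transform; it
rests on one distributional bound for the kernel that this produces.

Put F x = the integral over the sphere of |G (x . w, w)|, which dominates
|adjoint_radon G x|.  Averaging |G| over windows of half-width eps in the first
variable turns F into the integral of |G| against the kernel [band], which is
(2 eps)^-1 when |s - x . w| < eps and a <= s <= b, and 0 otherwise.  To bound
the integral of F^(2d) over a set E, pair F with phi^(2d-1), where phi is a
truncation of F restricted to E.  Young's inequality separates the L^2 norm of
G from the quadratic form in phi^(2d-1) of the symmetric kernel
k x y = integral of band (x, z) * band (y, z) dz.

Suppose that k has weak type d on E: the set of y with l < k x y has volume at
most A / l^d, for all x in E and l > 0.  Then, as for the
Hardy-Littlewood-Sobolev inequality, that form is at most
2 (c S^2 + C A S / c^(d-1)) for every c > 0, where S is the integral of phi^(2d)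
([bilinear_weak_kernel]).  As S is also at most the pairing of phi^(2d-1) with
F, a good choice of c leaves S <= C A ||G||^(2d), and the truncations increase
to F ([strong_from_duality]).  So everything reduces to finding A.

Up to the factor (2 eps)^-1, k x y is at most the area of the directions w for
which x . w is within eps of [a, b] and |x . w - y . w| <= 2 eps.  The surface
measure is defined by cones, so this is the volume of a set of w in the unit
ball.  Rotate so that x = (t, 0, ..., 0), and write r = |t| and y = (y1, y').

For the symmetric interval [-b, b], the constraints on x . w and y . w confine
w to a volume C eps b / (r |y'|), and also to a volume C eps / |y1 - t|.  So
l < k x y puts y into a cylinder of volume C (b / r)^(d-1) / l^d
([weak_type_symmetric]).

For 0 < a < b the cone condition a |w| <= x . w <= b |w| determines |w|^2 up to
an error of order (b - a) / a once x . w is known.  Besides its components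
along x and y', the vector w has d - 2 >= 2 further coordinates, and in
dimension at least 2 the volume of a spherical shell within the unit ball is
proportional to its thickness measured in |w|^2 ([lebesgue_shell]).  This gains
the factor b - a: k x y is at most C (b - a) / (r |y'|), and also at most
C (b - a) / (r eps).  Finally a direction w with a <= x . w and
|x . w - y . w| <= 2 eps exists only if |y1 - t| <= C (|y'| + eps) r / a.  Hence
y lies in a cylinder of volume C (b - a)^d / (a r^(d-1)) / l^d
([weak_type_annulus]).  Here the bound on b / a serves to have b <= d a.

All constants are uniform in eps, and eps tends to 0 by the Lebesgue
differentiation theorem on almost every line of the cylinder, together with
Fatou's lemma ([radon_limit]). *)

(** * Weak-type kernels and the Hardy-Littlewood-Sobolev inequality *)

Section dyadic_blocks.
Context {R : realType}.

Lemma dyadic_above (u : R) : 1 < u -> exists j, 4 ^+ j < u <= 4 ^+ j.+1.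
Proof.
move=> u1; have [n un] : exists n, u <= 4 ^+ n.
  exists (Num.bound u).
  apply: (le_trans (ltW (archi_boundP (ltW (lt_trans ltr01 u1))))).
  by rewrite -natrX ler_nat; apply/ltnW/ltn_expl.
have [[|j] hj jmin] := ex_minnP (ex_intro (fun n => u <= 4 ^+ n) n un).
  by move: hj; rewrite expr0 leNgt u1.
exists j; rewrite hj andbT ltNge; apply/negP => /jmin; by rewrite ltnn.
Qed.

Lemma dyadic_below (u : R) : 0 < u -> u <= 1 ->
  exists j, (4 ^+ j.+1)^-1 < u <= (4 ^+ j)^-1.
Proof.
move=> u0 u1; have [->|un1] := eqVneq u 1.
  by exists 0%N; rewrite expr0 invr1 lexx andbT expr1; lra.
have /dyadic_above[j /andP[ju uj]] : 1 < u^-1 by rewrite invf_gt1 // lt_neqAle un1.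
have [uj'|uj'] := ltP u^-1 (4 ^+ j.+1).
  exists j; rewrite -[u]invrK ltf_pV2 ?lef_pV2 ?posrE ?invr_gt0 ?exprn_gt0//.
  by rewrite uj' ltW.
exists j.+1; rewrite -[u]invrK ltf_pV2 ?lef_pV2 ?posrE ?invr_gt0 ?exprn_gt0//.
rewrite uj' andbT (le_lt_trans uj)// ltr_eXn2l//; lra.
Qed.
End dyadic_blocks.

Section weak_levels.
Context {R : realType}.

(** The first term is a bound for u^(2e+1) k on the block 4^j < k <= 4^(j+1),
where only u <= 1 is known; the second one is a bound on the block
4^-(j+1) < k <= 4^-j, where u^2 < k forces u <= 2^-j. *)
Definition dyadic_weight (e j : nat) (k : R) : R :=
  4 ^+ j.+1 * (4 ^+ j < k)%R%:R +
  (4 ^+ j * (2 ^+ j) ^+ (2 * e).+1)^-1 * ((4 ^+ j.+1)^-1 < k)%R%:R.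

Lemma dyadic_weight_ge0 e j k : 0 <= dyadic_weight e j k.
Proof.
by rewrite addr_ge0// mulr_ge0// ?invr_ge0 ?mulr_ge0// ?exprn_ge0// exprn_ge0.
Qed.

(** If k <= u^2 the bound is immediate.  Otherwise only the dyadic block of k
matters, and the pair (u, k) is absorbed by a function of k alone: this is what
lets the distribution function of k control the integral in [weak_lorentz]. *)
Lemma dyadic_domination e (u k : R) : 0 <= u <= 1 -> 0 <= k ->
  u ^+ (2 * e).+1 * k <= u ^+ (2 * e).+2 \/
  exists j, u ^+ (2 * e).+1 * k <= dyadic_weight e j k.
Proof.
move=> /andP[u0 u1] k0; have [ku|uk] := leP k (u ^+ 2).
  left; rewrite [leRHS]exprSr ler_wpM2l// ?exprn_ge0//.
  by apply: (le_trans ku); rewrite expr2 ler_piMl.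
have kp : 0 < k by apply: le_lt_trans uk; rewrite exprn_ge0.
right; have [k1|k1] := leP k 1.
  have [j /andP[jk kj]] := dyadic_below kp k1; exists j.
  rewrite /dyadic_weight jk mulr1 -[leLHS]add0r; apply: lerD.
    by apply: mulr_ge0; rewrite ?exprn_ge0.
  rewrite invfM mulrC ler_pM//; first by rewrite exprn_ge0.
  rewrite -exprVn lerXn2r ?nnegrE ?invr_ge0 ?exprn_ge0//.
  rewrite -(@ler_pXn2r _ 2) ?nnegrE ?invr_ge0 ?exprn_ge0//.
  rewrite exprVn -exprM mulnC exprM (_ : 2 ^+ 2 = 4); last by rewrite expr2; lra.
  exact: (le_trans (ltW uk)).
have [j /andP[jk kj]] := dyadic_above k1; exists j.
rewrite /dyadic_weight jk mulr1 -[leLHS]addr0; apply: lerD.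
  by apply: (le_trans _ kj); rewrite ler_piMl// exprn_ile1.
by rewrite mulr_ge0// invr_ge0 mulr_ge0// ?exprn_ge0.
Qed.

Lemma lee_nneseries_term (u : (\bar R)^nat) j : (forall i, (0 <= u i)%E) ->
  (u j <= \sum_(i <oo) u i)%E.
Proof.
move=> u0; apply: (le_trans _ (@nneseries_lim_ge _ u xpredT 0%N j.+1 _)) => //.
by rewrite big_nat_recr//= leeDr// sume_ge0.
Qed.

Lemma measurable_bool_natr d (T : measurableType d) (b : T -> bool) :
  measurable_fun setT b -> measurable_fun setT (fun x => (b x)%:R : R).
Proof. exact: (@measurableT_comp _ _ _ _ _ _ (fun b : bool => b%:R : R)). Qed.

Section level_sums.
Context d (Y : measurableType d) (mu : {measure set Y -> \bar R}).
Variables (e : nat) (k : Y -> R) (A : R).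
Hypotheses (e1 : (1 <= e)%N) (A0 : 0 <= A) (mk : measurable_fun setT k).
Hypothesis weak : forall l : R, 0 < l ->
  (mu [set y | (l < k y)%R] <= (A / l ^+ e.+1)%:E)%E.

Lemma measurable_ltr_cst (l : R) : measurable [set y : Y | l < k y].
Proof.
have -> : [set y | l < k y] = k @^-1` `]l, +oo[.
  by apply/seteqP; split => y /=; rewrite in_itv /= andbT.
by rewrite -[X in measurable X]setTI; exact: mk.
Qed.

Lemma measurable_ltr_natr (l th : R) :
  measurable_fun setT (fun y => (l < k y / th)%R%:R : R).
Proof.
apply: measurable_bool_natr.
by apply: measurable_fun_ltr => //; apply: measurable_funM.
Qed.

Lemma measurable_dyadic_weight j th :
  measurable_fun setT (fun y => dyadic_weight e j (k y / th)).
Proof.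
by apply: measurable_funD; apply: measurable_funM => //; exact: measurable_ltr_natr.
Qed.

(** On the large blocks the weight 4^(j+1) is beaten by the decay (4^j)^-(e+1) of
the distribution, as e >= 1.  On the small ones the weight is 2^-((2e+3)j), and
it beats the growth 4^((e+1)(j+1)) of the distribution by a factor 2^-j. *)
Lemma integral_dyadic_weight j (th : R) : 0 < th ->
  (\int[mu]_y (dyadic_weight e j (k y / th))%:E <=
    ((4 ^+ e.+1 + 4) * 2 * A / th ^+ e.+1 / (2 ^ j.+1)%:R)%:E)%E.
Proof.
move=> th0.
have ind (l : R) : 0 < l -> (\int[mu]_y ((l < k y / th)%R%:R)%:E <=
     (A / (th * l) ^+ e.+1)%:E)%E.
  move=> l0; apply: le_trans (weak _); last by rewrite mulr_gt0.
  rewrite -[X in (_ <= mu X)%E]setIT -integral_indic//; last exact: measurable_ltr_cst.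
  rewrite le_eqVlt; apply/orP; left; apply/eqP; apply: eq_integral => y _.
  by rewrite indicE mem_setE /= ltr_pdivlMr// mulrC.
have mind l := measurable_ltr_natr l th.
have w0 : 0 <= (4 ^+ j * (2 ^+ j) ^+ (2 * e).+1)^-1 :> R.
  by rewrite invr_ge0 mulr_ge0 ?exprn_ge0.
rewrite /dyadic_weight; under eq_integral do rewrite EFinD.
rewrite ge0_integralD//; last 2 first.
- by apply/measurable_EFinP; apply: measurable_funM.
- by apply/measurable_EFinP; apply: measurable_funM.
under eq_integral do rewrite EFinM.
rewrite ge0_integralZl_EFin//; last exact/measurable_EFinP.
under [X in (_ + X)%E]eq_integral do rewrite EFinM.
rewrite ge0_integralZl_EFin//; last exact/measurable_EFinP.
have j40 : 0 < 4 ^+ j :> R by rewrite exprn_gt0.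
have j410 : 0 < (4 ^+ j.+1)^-1 :> R by rewrite invr_gt0 exprn_gt0.
apply: (le_trans (leeD (lee_wpmul2l _ (ind _ j40)) (lee_wpmul2l _ (ind _ j410)))).
  by rewrite lee_fin exprn_ge0.
  by rewrite lee_fin.
rewrite -!EFinM -EFinD lee_fin !exprMn !exprVn !invfM !invrK.
have -> : (2 ^ j.+1)%:R = 2 * 2 ^+ j :> R by rewrite natrX exprS.
set B := A / th ^+ e.+1.
have B0 : 0 <= B by rewrite divr_ge0// exprn_ge0// ltW.
have -> : (4 ^+ e.+1 + 4) * 2 * A / th ^+ e.+1 * (2 * 2 ^+ j)^-1 =
   B * (4 * (2 ^+ j)^-1) + B * (4 ^+ e.+1 * (2 ^+ j)^-1).
  by rewrite /B invfM; field; rewrite !gt_eqF// exprn_gt0.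
set p := 2 ^+ j : R.
have p1 : 1 <= p by rewrite exprn_ege1 ?ler1n.
have p0 : 0 < p by apply: lt_le_trans p1.
have e4 : 4 ^+ j = p ^+ 2 by rewrite -exprM mulnC exprM; congr (_ ^+ j); lra.
apply: lerD.
  rewrite exprS e4 [leLHS](_ : _ = B * (4 * ((p ^+ 2) ^+ e)^-1)); last first.
    have : (p ^+ 2) ^+ e != 0 by rewrite gt_eqF// !exprn_gt0.
    have : th ^+ e != 0 by rewrite gt_eqF// !exprn_gt0.
    have : p ^+ 2 != 0 by rewrite gt_eqF// !exprn_gt0.
    rewrite /B !(exprS _ e); move: (p ^+ 2) => q q0.
    move: (q ^+ e) (th ^+ e) => q' t' t0 q'0.
    by field; rewrite t0 q0 q'0 gt_eqF.
  rewrite ler_wpM2l// ler_wpM2l// lef_pV2 ?posrE ?exprn_gt0//.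
  by rewrite -exprM -[leLHS]expr1 ler_weXn2l// muln_gt0.
rewrite (exprS 4 j) e4 [leLHS](_ : _ = B * (4 ^+ e.+1 * p^-1))//.
have : p ^+ (2 * e) != 0 by rewrite gt_eqF// !exprn_gt0.
have : th ^+ e.+1 != 0 by rewrite gt_eqF// !exprn_gt0.
rewrite /B exprMn -(exprM p 2 e.+1) mulnS exprD (exprS p (2 * e)).
move: (th ^+ e.+1) (4 ^+ e.+1) (p ^+ (2 * e)) => T F P T0 P0.
by field; rewrite T0 P0 gt_eqF.
Qed.
End level_sums.
End weak_levels.

Section hardy_littlewood_sobolev.
Context {R : realType}.

(** Splitting at k = c phi^2: below the threshold the integrand is at most
c t phi^(2e+2); above it, [dyadic_domination] applied to phi / t and
k / (c t^2) leaves a sum over dyadic levels of k.  The constant c is kept free,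
and is chosen only once the final inequality is assembled. *)
Lemma weak_lorentz d (Y : measurableType d) (mu : {measure set Y -> \bar R})
    (e : nat) (phi k : Y -> R) (A S t c : R) :
  (1 <= e)%N -> 0 <= A -> measurable_fun setT phi -> measurable_fun setT k ->
  (forall y, 0 <= phi y) -> (forall y, 0 <= k y) ->
  (forall l : R, 0 < l -> (mu [set y | (l < k y)%R] <= (A / l ^+ e.+1)%:E)%E) ->
  (\int[mu]_y (phi y ^+ (2 * e).+2)%:E <= S%:E)%E ->
  0 < t -> 0 < c ->
  (\int[mu]_y ((phi y <= t)%R%:R * (phi y ^+ (2 * e).+1 * k y))%:E <=
   (t * (c * S + (4 ^+ e.+1 + 4) * 2 * A / c ^+ e))%:E)%E.
Proof.
move=> e1 A0 mphi mk phi0 k0 wk phiS t0 c0.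
set n := (2 * e).+1; pose th := c * t ^+ 2.
have th0 : 0 < th by rewrite mulr_gt0// exprn_gt0.
have tn0 : 0 <= t ^+ n * th by rewrite mulr_ge0 ?exprn_ge0// ltW.
have ct0 : 0 <= c * t by rewrite mulr_ge0 ?ltW.
pose f y := (c * t * phi y ^+ n.+1)%:E.
pose g j y := ((t ^+ n * th) * dyadic_weight e j (k y / th))%:E.
have f0 y : (0 <= f y)%E by rewrite lee_fin mulr_ge0// exprn_ge0.
have g0 j y : (0 <= g j y)%E by rewrite lee_fin mulr_ge0// dyadic_weight_ge0.
have mg j : measurable_fun setT (g j).
  by apply/measurable_EFinP; apply: measurable_funM => //; apply: measurable_dyadic_weight.
have mf : measurable_fun setT f.
  by apply/measurable_EFinP; apply: measurable_funM => //; apply: measurable_funX.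
have mG : measurable_fun setT (fun y => \sum_(j <oo) g j y)%E.
  by apply: ge0_emeasurable_sum.
have pt y : (((phi y <= t)%R%:R * (phi y ^+ n * k y))%:E <=
    f y + \sum_(j <oo) g j y)%E.
  have G0 : (0 <= \sum_(j <oo) g j y)%E by apply: nneseries_ge0.
  have [yt|] := leP (phi y) t; last by rewrite mul0r adde_ge0.
  rewrite mul1r; have u01 : 0 <= phi y / t <= 1.
    by rewrite divr_ge0 ?(ltW t0)// ler_pdivrMr// mul1r.
  have kk0 : 0 <= k y / th by rewrite divr_ge0 ?(ltW th0).
  have E1 : phi y ^+ n * k y = (t ^+ n * th) * ((phi y / t) ^+ n * (k y / th)).
    by rewrite expr_div_n; field; rewrite gt_eqF// gt_eqF// exprn_gt0.
  rewrite E1; have [le|[j le]] := dyadic_domination e u01 kk0.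
    apply: (@le_trans _ _ (f y)); last by rewrite leeDl.
    rewrite lee_fin; apply: (le_trans (ler_wpM2l tn0 le)).
    rewrite -/n expr_div_n /th (exprSr t n) le_eqVlt; apply/orP; left; apply/eqP.
    by field; rewrite gt_eqF// gt_eqF// exprn_gt0.
  apply: (@le_trans _ _ (\sum_(j <oo) g j y)%E); last by rewrite leeDr.
  apply: le_trans (lee_nneseries_term j _) => //.
  by rewrite lee_fin ler_wpM2l.
have mI : measurable_fun setT (fun y => ((phi y <= t)%R%:R * (phi y ^+ n * k y))%:E).
  apply/measurable_EFinP; apply: measurable_funM.
    by apply: measurable_bool_natr; apply: measurable_fun_ler.
  by apply: measurable_funM => //; apply: measurable_funX.
apply: (@le_trans _ _ (\int[mu]_y (f y + \sum_(j <oo) g j y))%E).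
  apply: ge0_le_integral => //.
  - by move=> y _; rewrite lee_fin mulr_ge0// mulr_ge0// exprn_ge0.
  - by apply: emeasurable_funD.
rewrite ge0_integralD//; last by move=> y _; apply: nneseries_ge0.
rewrite integral_nneseries// mulrDr EFinD; apply: leeD.
  under eq_integral do rewrite /f EFinM.
  rewrite ge0_integralZl_EFin//; last 2 first.
  - by move=> y _; rewrite lee_fin exprn_ge0.
  - by apply/measurable_EFinP; apply: measurable_funX.
  apply: (le_trans (lee_wpmul2l _ phiS)) => //.
  by rewrite -EFinM mulrA [t * c]mulrC.
have C0 : 0 <= (4 ^+ e.+1 + 4) * 2 * A :> R.
  by rewrite mulr_ge0// mulr_ge0// addr_ge0// exprn_ge0.
apply: (@le_trans _ _ (\sum_(j <oo) (t ^+ n * th *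
    ((4 ^+ e.+1 + 4) * 2 * A / th ^+ e.+1) / (2 ^ j.+1)%:R)%:E)%E).
  apply: lee_nneseries => [j _ _|j _]; first exact: integral_ge0.
  rewrite /g; under eq_integral do rewrite EFinM.
  rewrite ge0_integralZl_EFin//; last 2 first.
  - by move=> y _; rewrite lee_fin dyadic_weight_ge0.
  - by apply/measurable_EFinP; apply: measurable_dyadic_weight.
  apply: (le_trans (lee_wpmul2l _ (integral_dyadic_weight e1 A0 mk wk j th0))) => //.
  by rewrite -EFinM -!mulrA.
apply: (le_trans (epsilon_trick0 _ _)).
  by rewrite mulr_ge0// divr_ge0// exprn_ge0// ltW.
rewrite lee_fin le_eqVlt; apply/orP; left; apply/eqP.
have ce : c ^+ e != 0 by rewrite gt_eqF// exprn_gt0.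
have te : t ^+ (2 * e) != 0 by rewrite gt_eqF// exprn_gt0.
rewrite /n /th (exprS t (2 * e)) (exprS (c * t ^+ 2) e) exprMn -(exprM t 2 e).
move: (c ^+ e) (t ^+ (2 * e)) ce te => C T C' T'.
by field; rewrite C' T' !gt_eqF.
Qed.

Section bilinear.
Context d (X : measurableType d) (mu : {sigma_finite_measure set X -> \bar R}).
Variables (e : nat) (phi : X -> R) (k : X * X -> R) (E : set X) (A S c : R).
Hypotheses (e1 : (1 <= e)%N) (A0 : 0 <= A) (c0 : 0 < c).
Hypotheses (mphi : measurable_fun setT phi) (mk : measurable_fun setT k).
Hypotheses (phi0 : forall y, 0 <= phi y) (k0 : forall y, 0 <= k y).
Hypothesis ksym : forall x y, k (x, y) = k (y, x).
Hypothesis wk : forall x, E x -> forall l : R, 0 < l ->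
  (mu [set y | (l < k (x, y))%R] <= (A / l ^+ e.+1)%:E)%E.
Hypothesis phiE : forall x, ~ E x -> phi x = 0.
Hypothesis phiS : (\int[mu]_y (phi y ^+ (2 * e).+2)%:E <= S%:E)%E.

(** By symmetry of k it suffices to integrate over phi y <= phi x, and there the
inner integral is the one of [weak_lorentz] with t = phi x; the factor t
completes phi^(2e+1) x to phi^(2e+2) x. *)
Lemma bilinear_weak_kernel :
  (\int[mu]_x \int[mu]_y (phi x ^+ (2 * e).+1 * phi y ^+ (2 * e).+1 * k (x, y))%:E
   <= (2 * (c * S ^+ 2 + (4 ^+ e.+1 + 4) * 2 * A * S / c ^+ e))%:E)%E.
Proof.
set n := (2 * e).+1.
pose w (p : X * X) : \bar R :=
  (phi p.1 ^+ n * ((phi p.2 <= phi p.1)%R%:R * (phi p.2 ^+ n * k p)))%:E.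
have w0 p : (0 <= w p)%E by rewrite lee_fin !mulr_ge0// ?exprn_ge0// ?mulr_ge0// exprn_ge0.
have m1 : measurable_fun setT (fun p : X * X => phi p.1) by exact: measurableT_comp.
have m2 : measurable_fun setT (fun p : X * X => phi p.2) by exact: measurableT_comp.
have mw : measurable_fun setT w.
  apply/measurable_EFinP; apply: measurable_funM; first exact: measurable_funX.
  apply: measurable_funM.
    by apply: measurable_bool_natr; apply: measurable_fun_ler.
  by apply: measurable_funM => //; apply: measurable_funX.
have mws : measurable_fun setT (fun p => w (p.2, p.1)).
  by apply: (measurableT_comp mw); exact: measurable_swap.
have mf : measurable_fun setT
    (fun p : X * X => (phi p.1 ^+ n * phi p.2 ^+ n * k p)%:E).
  apply/measurable_EFinP; apply: measurable_funM => //.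
  by apply: measurable_funM; apply: measurable_funX.
have f0 p : (0 <= (phi p.1 ^+ n * phi p.2 ^+ n * k p)%:E)%E.
  by rewrite lee_fin !mulr_ge0// exprn_ge0.
have Iw : (\int[mu]_x \int[mu]_y w (x, y) <=
    (c * S ^+ 2 + (4 ^+ e.+1 + 4) * 2 * A * S / c ^+ e)%:E)%E.
  set K := c * S + (4 ^+ e.+1 + 4) * 2 * A / c ^+ e.
  have S0 : 0 <= S.
    rewrite -lee_fin; apply: le_trans phiS; apply: integral_ge0 => y _.
    by rewrite lee_fin exprn_ge0.
  have K0 : 0 <= K.
    apply: addr_ge0; first by rewrite mulr_ge0// ltW.
    apply: divr_ge0; last by rewrite exprn_ge0// ltW.
    by rewrite mulr_ge0// mulr_ge0// addr_ge0// exprn_ge0.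
  apply: (@le_trans _ _ (\int[mu]_x (K%:E * (phi x ^+ n.+1)%:E))%E).
    apply: ge0_le_integral => //.
    - by move=> x _; apply: integral_ge0.
    - exact: (measurable_fun_fubini_tonelli_F w).
    - by apply/measurable_EFinP; apply: measurable_funM => //; apply: measurable_funX.
    move=> x _; have [phix|phix] := leP (phi x) 0.
      have -> : phi x = 0 by apply/eqP; rewrite eq_le phix phi0.
      rewrite integral0_eq; first by rewrite expr0n/= mule0.
      move=> y _; rewrite /w /=.
      by have -> : phi x = 0 by [apply/eqP; rewrite eq_le phix phi0]; rewrite expr0n/= mul0r.
    have Ex : E x by apply: contrapT => /phiE phiE0; rewrite phiE0 ltxx in phix.
    rewrite /w /=; under eq_integral do rewrite EFinM.
    have mkx : measurable_fun setT (fun y => k (x, y)) by exact: measurableT_comp.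
    rewrite ge0_integralZl_EFin//; last 3 first.
    - by move=> y _; rewrite lee_fin !mulr_ge0// exprn_ge0.
    - apply/measurable_EFinP; apply: measurable_funM.
        by apply: measurable_bool_natr; apply: measurable_fun_ler.
      by apply: measurable_funM => //; apply: measurable_funX.
    - by rewrite exprn_ge0.
    apply: (le_trans (lee_wpmul2l _ (weak_lorentz e1 A0 mphi mkx phi0 _ (wk Ex) phiS phix c0))) => //.
      by rewrite lee_fin exprn_ge0.
    by rewrite -/K -!EFinM lee_fin [phi x ^+ n.+1]exprSr mulrA mulrC.
  rewrite ge0_integralZl_EFin//; last 2 first.
  - by move=> y _; rewrite lee_fin exprn_ge0.
  - by apply/measurable_EFinP; apply: measurable_funX.
  apply: (le_trans (lee_wpmul2l _ phiS)); first by rewrite lee_fin.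
  by rewrite -EFinM lee_fin /K le_eqVlt; apply/orP; left; apply/eqP; ring.
rewrite -(fubini_tonelli1 (fun p : X * X => (phi p.1 ^+ n * phi p.2 ^+ n * k p)%:E))//.
apply: (@le_trans _ _ (\int[(mu \x mu)%E]_p (w p + w (p.2, p.1)))%E).
  apply: ge0_le_integral => //; first exact: emeasurable_funD.
  move=> [x y] _; rewrite /w /= -EFinD lee_fin (ksym y x).
  have [xy|yx] := leP (phi x) (phi y); have [yx'|xy'] := leP (phi y) (phi x).
  - rewrite !mul1r mulrA lerDl !mulr_ge0// exprn_ge0//.
  - by rewrite mul0r mulr0 add0r mul1r mulrA [phi x ^+ n * _]mulrC.
  - by rewrite mul0r mulr0 addr0 mul1r mulrA.
  - by have := lt_trans xy' yx; rewrite ltxx.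
rewrite ge0_integralD//.
rewrite (fubini_tonelli2 (fun p => w (p.2, p.1)))// (fubini_tonelli1 w)//.
by rewrite mulr_natl mulr2n EFinD; apply: leeD.
Qed.
End bilinear.
End hardy_littlewood_sobolev.

(** * The T T-star argument and duality *)

Section tt_star.
Context {R : realType}.

Section tt_star_kernel.
Context d1 d2 (X : measurableType d1) (Z : measurableType d2).
Variable mu : {sigma_finite_measure set X -> \bar R}.
Variable nu : {sigma_finite_measure set Z -> \bar R}.
Variables (e : nat) (phi : X -> R) (g : Z -> R) (K : X * Z -> R) (E : set X).
Variables (A S N c del : R).
Hypotheses (e1 : (1 <= e)%N) (A0 : 0 <= A) (c0 : 0 < c) (del0 : 0 < del).
Hypotheses (mphi : measurable_fun setT phi) (mK : measurable_fun setT K).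
Hypotheses (phi0 : forall y, 0 <= phi y) (K0 : forall p, 0 <= K p).
Hypotheses (mg : measurable_fun setT g) (g0 : forall z, 0 <= g z).
Hypothesis Kfin : forall x y,
  (\int[nu]_z (K (x, z) * K (y, z))%:E < +oo)%E.
Hypothesis wk : forall x, E x -> forall l : R, 0 < l ->
  (mu [set y | l%:E < \int[nu]_z (K (x, z) * K (y, z))%:E] <= (A / l ^+ e.+1)%:E)%E.
Hypothesis phiE : forall x, ~ E x -> phi x = 0.
Hypothesis phiS : (\int[mu]_y (phi y ^+ (2 * e).+2)%:E <= S%:E)%E.
Hypothesis gN : (\int[nu]_z (g z ^+ 2)%:E <= N%:E)%E.

Let n := (2 * e).+1.
Let f x := phi x ^+ n.
Let f0 x : 0 <= f x. Proof. exact: exprn_ge0. Qed.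
Let mf : measurable_fun setT f. Proof. exact: measurable_funX. Qed.
Let kk (p : X * X) : \bar R := (\int[nu]_z (K (p.1, z) * K (p.2, z))%:E)%E.
Let k p := fine (kk p).
Let P z := (\int[mu]_x (f x * K (x, z))%:E)%E.

Let mKx x : measurable_fun setT (fun z => K (x, z)).
Proof. exact: measurableT_comp. Qed.
Let mKz z : measurable_fun setT (fun x => K (x, z)).
Proof. exact: measurableT_comp. Qed.

Let P0 z : (0 <= P z)%E.
Proof. by apply: integral_ge0 => x _; rewrite lee_fin mulr_ge0. Qed.

Let mP : measurable_fun setT P.
Proof.
apply: (measurable_fun_fubini_tonelli_G (fun p : X * Z => (f p.1 * K p)%:E)).
  apply/measurable_EFinP; apply: measurable_funM => //.
  exact: measurableT_comp.
by move=> p; rewrite lee_fin mulr_ge0.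
Qed.

Let kkE p : kk p = (k p)%:E.
Proof.
rewrite fineK// ge0_fin_numE; last by apply: integral_ge0 => z _; rewrite lee_fin mulr_ge0.
exact: Kfin.
Qed.

Let mk : measurable_fun setT k.
Proof.
apply/measurable_EFinP.
rewrite (_ : _ \o _ = kk); last by apply/funext => p; rewrite kkE.
apply: (measurable_fun_fubini_tonelli_F
  (fun q : (X * X) * Z => (K (q.1.1, q.2) * K (q.1.2, q.2))%:E)).
  apply/measurable_EFinP; apply: measurable_funM; apply: measurableT_comp => //.
    apply: measurable_fun_pair => //.
    by apply: (measurableT_comp measurable_fst).
  apply: measurable_fun_pair => //.
  by apply: (measurableT_comp measurable_snd).
by move=> p; rewrite lee_fin mulr_ge0.
Qed.

Lemma integral_sqr_adjoint :
  (\int[nu]_z (P z * P z) = \int[mu]_x \int[mu]_y (f x * f y * k (x, y))%:E)%E.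
Proof.
pose h (q : (Z * X) * X) := ((f q.1.2 * K (q.1.2, q.1.1)) * (f q.2 * K (q.2, q.1.1)))%:E.
have h0 q : (0 <= h q)%E by rewrite lee_fin !mulr_ge0.
have m12 : measurable_fun setT (fun q : (Z * X) * X => q.1.2) by exact: (measurableT_comp measurable_snd).
have m11 : measurable_fun setT (fun q : (Z * X) * X => q.1.1) by exact: (measurableT_comp measurable_fst).
have mh : measurable_fun setT h.
  apply/measurable_EFinP; apply: measurable_funM; apply: measurable_funM.
  - exact: measurableT_comp.
  - by apply: measurableT_comp => //; apply: measurable_fun_pair.
  - exact: measurableT_comp.
  - by apply: measurableT_comp => //; apply: measurable_fun_pair.
have PP z : (P z * P z = \int[mu]_x \int[mu]_y h ((z, x), y))%E.
  rewrite {1}/P -ge0_integralZr//; last first.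
  - by move=> x _; rewrite lee_fin mulr_ge0.
  - by apply/measurable_EFinP; apply: measurable_funM.
  apply: eq_integral => x _; rewrite /h /= /P -ge0_integralZl_EFin//; last 3 first.
  - by move=> y _; rewrite lee_fin mulr_ge0.
  - by apply/measurable_EFinP; apply: measurable_funM.
  - by rewrite mulr_ge0.
under eq_integral do rewrite PP.
rewrite (fubini_tonelli (fun p : Z * X => (\int[mu]_y h (p, y))%E)); last 2 first.
- exact: (measurable_fun_fubini_tonelli_F h).
- by move=> p; apply: integral_ge0.
apply: eq_integral => x _.
rewrite (fubini_tonelli (fun p : Z * X => h ((p.1, x), p.2))); last 2 first.
- apply: (measurableT_comp mh); apply: measurable_fun_pair => //.
  exact: measurable_fun_pair.
- by [].
apply: eq_integral => y _; rewrite EFinM -kkE /kk -ge0_integralZl_EFin//; last 3 first.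
- by move=> z _; rewrite lee_fin mulr_ge0.
- by apply/measurable_EFinP; apply: measurable_funM.
- by rewrite mulr_ge0.
by apply: eq_integral => z _; rewrite /h /= -EFinM mulrACA.
Qed.

(** Young's inequality g P <= del g^2 / 2 + P^2 / (2 del) replaces the
Cauchy-Schwarz inequality, since P may take infinite values.  The square of P
integrates to the bilinear form of the kernel. *)
Lemma tt_star_weak :
  (\int[mu]_x ((f x)%:E * \int[nu]_z (K (x, z) * g z)%:E) <=
   (del * N / 2 + (c * S ^+ 2 + (4 ^+ e.+1 + 4) * 2 * A * S / c ^+ e) / del)%:E)%E.
Proof.
have -> : (\int[mu]_x ((f x)%:E * \int[nu]_z (K (x, z) * g z)%:E) =
    \int[nu]_z ((g z)%:E * P z))%E.
  transitivity (\int[mu]_x \int[nu]_z (f x * (K (x, z) * g z))%:E)%E.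
    apply: eq_integral => x _; rewrite -ge0_integralZl_EFin//.
    - by move=> z _; rewrite lee_fin mulr_ge0.
    - by apply/measurable_EFinP; apply: measurable_funM.
  rewrite (fubini_tonelli (fun p : X * Z => (f p.1 * (K p * g p.2))%:E)); last 2 first.
  - apply/measurable_EFinP; apply: measurable_funM; first exact: measurableT_comp.
    by apply: measurable_funM => //; exact: measurableT_comp.
  - by move=> p; rewrite lee_fin !mulr_ge0.
  apply: eq_integral => z _; rewrite /P -ge0_integralZl_EFin//.
  - by apply: eq_integral => x _; rewrite -EFinM; congr EFin; ring.
  - by move=> x _; rewrite lee_fin mulr_ge0.
  - by apply/measurable_EFinP; apply: measurable_funM.
have young z : ((g z)%:E * P z <=
    (del / 2)%:E * (g z ^+ 2)%:E + ((2 * del)^-1)%:E * (P z * P z))%E.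
  have [->|] := eqVneq (P z) +oo%E.
    rewrite mulyy [X in (_ <= _ + X)%E]gt0_muley ?lte_fin ?invr_gt0 ?mulr_gt0//.
    by rewrite addey ?leey.
  rewrite -ltey => Pfin; have /fineK <- : P z \is a fin_num by rewrite ge0_fin_numE.
  set p := fine (P z); rewrite -!EFinM -EFinD lee_fin -subr_ge0.
  have -> : del / 2 * g z ^+ 2 + (2 * del)^-1 * (p * p) - g z * p =
     (2 * del)^-1 * (del * g z - p) ^+ 2 by field; rewrite gt_eqF.
  by rewrite mulr_ge0 ?sqr_ge0// invr_ge0 mulr_ge0 ?ltW.
have mg2 : measurable_fun setT (fun z => (g z ^+ 2)%:E).
  by apply/measurable_EFinP; apply: measurable_funX.
have mPP : measurable_fun setT (fun z => (P z * P z)%E) by exact: emeasurable_funM.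
have d20 : 0 <= del / 2 by rewrite divr_ge0// ltW.
have id20 : 0 <= (2 * del)^-1 by rewrite invr_ge0 mulr_ge0// ltW.
apply: (@le_trans _ _ (\int[nu]_z ((del / 2)%:E * (g z ^+ 2)%:E + ((2 * del)^-1)%:E * (P z * P z)))%E).
  apply: ge0_le_integral => //.
  - by move=> z _; rewrite mule_ge0 ?lee_fin.
  - by apply: emeasurable_funM => //; apply/measurable_EFinP.
  - by apply: emeasurable_funD; apply: emeasurable_funM.
rewrite ge0_integralD//; last 4 first.
- by move=> z _; rewrite mule_ge0 ?lee_fin// exprn_ge0.
- exact: emeasurable_funM.
- by move=> z _; rewrite mule_ge0 ?lee_fin// mule_ge0.
- by apply: emeasurable_funM.
rewrite ge0_integralZl_EFin//; last by move=> z _; rewrite lee_fin exprn_ge0.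
rewrite ge0_integralZl_EFin//; last by move=> z _; rewrite mule_ge0.
rewrite integral_sqr_adjoint.
have ksym x y : k (x, y) = k (y, x).
  by rewrite /k /kk; congr fine; apply: eq_integral => z _; rewrite mulrC.
have wk' x : E x -> forall l : R, 0 < l ->
    (mu [set y | (l < k (x, y))%R] <= (A / l ^+ e.+1)%:E)%E.
  move=> Ex l l0; rewrite (_ : [set y | _] =
    [set y | l%:E < \int[nu]_z (K (x, z) * K (y, z))%:E]%E); first exact: wk.
  apply/seteqP; split => y /=; rewrite -[X in _ -> X]/(is_true _) -?lte_fin;
  by have := kkE (x, y); rewrite /kk /= => ->.
have kp0 p : 0 <= k p.
  by rewrite /k fine_ge0//; apply: integral_ge0 => z _; rewrite lee_fin mulr_ge0.
apply: (le_trans (leeD (lee_wpmul2l _ gN) (lee_wpmul2l _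
  (bilinear_weak_kernel e1 A0 c0 mphi mk phi0 kp0 ksym wk' phiE phiS)))) => //.
rewrite -!EFinM -EFinD lee_fin le_eqVlt; apply/orP; left; apply/eqP.
by field; rewrite !gt_eqF// exprn_gt0.
Qed.
End tt_star_kernel.
End tt_star.

Section duality.
Context {R : realType}.

(** The choice c = 1 / (4 N), del = S / N makes the terms that are linear in S on
the right-hand side add up to 3 S / 4.  When N = 0 the freedom in del alone
forces S = 0. *)
Lemma self_improving_bound (e : nat) (S N B : R) : 0 <= S -> 0 <= N -> 0 <= B ->
  (forall c del : R, 0 < c -> 0 < del ->
    S <= del * N / 2 + (c * S ^+ 2 + B * S / c ^+ e) / del) ->
  S <= B * (4 * N) ^+ e.+1.
Proof.
move=> S0 N0 B0 H; have K0 : 0 <= B * (4 * N) ^+ e.+1.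
  by rewrite mulr_ge0// exprn_ge0// mulr_ge0.
have [->//|Sn0] := eqVneq S 0; have Sp : 0 < S by rewrite lt_neqAle eq_sym Sn0.
(* with N = 0, c = 1 and del = 2 (S + B) the bound reads S <= S / 2 *)
have [N00|Nn0] := eqVneq N 0.
  have SB : 0 < S + B by rewrite ltr_wpDr.
  have := H 1 (2 * (S + B)) ltr01 (mulr_gt0 (ltr0Sn _ _) SB).
  rewrite N00 mulr0 mul0r add0r mul1r expr1n divr1 expr2 -mulrDl.
  have -> : (S + B) * S / (2 * (S + B)) = S / 2 by field; rewrite gt_eqF.
  move=> SS; have : S <= 0 by lra.
  by move=> Sle; rewrite leNgt in Sle; move: Sle; rewrite Sp.
have Np : 0 < N by rewrite lt_neqAle eq_sym Nn0.
have := H (4 * N)^-1 (S / N).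
rewrite invr_gt0 mulr_gt0// divr_gt0// => /(_ isT isT).
rewrite exprVn invrK (_ : S / N * N / 2 = S / 2); last by field.
rewrite [X in _ <= _ + X](_ : _ = S / 4 + B * (4 * N) ^+ e * N); last first.
  by field; rewrite Sn0 Nn0.
rewrite exprS => Hle.
have : S / 4 <= B * (4 * N) ^+ e * N by lra.
set Q := (4 * N) ^+ e; nra.
Qed.

Lemma lee_expe2r (x y : \bar R) n : (0 <= x -> x <= y -> x ^+ n <= y ^+ n)%E.
Proof.
move=> x0 xy; elim: n => [|n IH]; first by rewrite !expe0.
by rewrite !expeS lee_pmul// expe_ge0.
Qed.

(** A bound for the integrals of all phi^(p+1) with phi <= F is applied to
phi = min(F, m) on the part of E inside a set of finite measure; these have a
finite integral, and increase to F on E. *)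
Lemma lower_truncations d (X : measurableType d)
    (mu : {sigma_finite_measure set X -> \bar R}) (p : nat)
    (F : X -> \bar R) (E : set X) (C : R) :
  measurable E -> measurable_fun setT F -> (forall x, 0 <= F x)%E ->
  (forall (phi : X -> R) (S : R), measurable_fun setT phi ->
    (forall x, 0 <= phi x) -> (forall x, ~ E x -> phi x = 0) ->
    (forall x, (phi x)%:E <= F x)%E ->
    (\int[mu]_x (phi x ^+ p.+1)%:E = S%:E)%E -> S <= C) ->
  (\int[mu]_(x in E) F x ^+ p.+1 <= C%:E)%E.
Proof.
move=> mE mF F0 H.
have /sigma_finiteP[D [TD ndD Doo]] := sigma_finiteT mu.
have mD m : measurable (D m) by have [] := Doo m.
pose phi m x := fine (mine (F x) m%:R%:E) * \1_(E `&` D m) x.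
have minfin m x : mine (F x) m%:R%:E \is a fin_num.
  rewrite ge0_fin_numE; last by rewrite le_min F0 lee_fin ler0n.
  by rewrite (le_lt_trans _ (ltry m%:R))// ge_min lexx orbT.
have min0 m x : 0 <= fine (mine (F x) m%:R%:E).
  by rewrite fine_ge0// le_min F0 lee_fin ler0n.
have phi0 m x : 0 <= phi m x by rewrite mulr_ge0.
have mphi m : measurable_fun setT (phi m).
  apply: measurable_funM; last by apply: measurable_indic; apply: measurableI.
  apply/measurable_EFinP.
  rewrite (_ : _ \o _ = fun x => mine (F x) m%:R%:E); last first.
    by apply/funext => x /=; rewrite fineK.
  exact: measurable_mine.
have phile m x : ((phi m x)%:E <= F x)%E.
  rewrite /phi indicE; case: (x \in _); last by rewrite mulr0.
  by rewrite mulr1 fineK// ge_min lexx.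
have phim m x : phi m x <= m%:R * \1_(D m) x.
  rewrite /phi ler_pM//.
    by rewrite -lee_fin fineK// ge_min lexx orbT.
  by rewrite !indicE in_setI; case: (x \in E); case: (x \in D m).
have phiE m x : ~ E x -> phi m x = 0.
  by move=> Ex; rewrite /phi indicE memNset ?mulr0// => -[].
pose h m x := (phi m x ^+ p.+1)%:E.
have mh m : measurable_fun setT (h m).
  by apply/measurable_EFinP; apply: measurable_funX.
have h0 m x : (0 <= h m x)%E by rewrite lee_fin exprn_ge0.
have hfin m : (\int[mu]_x h m x < +oo)%E.
  apply: (@le_lt_trans _ _ (\int[mu]_x ((m%:R ^+ p.+1)%:E * (\1_(D m) x)%:E))%E).
    apply: ge0_le_integral => //.
      by apply: emeasurable_funM => //; apply/measurable_EFinP; exact: measurable_indic.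
    move=> x _; rewrite lee_fin.
    apply: (le_trans (lerXn2r _ _ _ (phim m x))); rewrite ?nnegrE ?mulr_ge0//.
    by rewrite exprMn indicE; case: (x \in _); rewrite ?expr1n ?expr0n/= ?mulr0 ?mulr1.
  rewrite ge0_integralZl_EFin ?exprn_ge0//; last first.
    by apply/measurable_EFinP; exact: measurable_indic.
  rewrite integral_indic// setIT lte_mul_pinfty// ?lee_fin ?exprn_ge0//.
  by have [] := Doo m.
have hC m : (\int[mu]_x h m x <= C%:E)%E.
  have hf : (\int[mu]_x h m x)%E \is a fin_num by rewrite ge0_fin_numE// integral_ge0.
  rewrite -(fineK hf) lee_fin; apply: (H (phi m)) => //.
  - exact: phiE.
  - by rewrite fineK.
have ndh x : {homo h^~ x : m q / (m <= q)%N >-> (m <= q)%E}.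
  move=> m q mq; rewrite lee_fin lerXn2r ?nnegrE//.
  rewrite /phi ler_pM//.
    by rewrite fine_le// le_min !ge_min lexx /= lee_fin ler_nat mq orbT.
  rewrite !indicE !in_setI; case: (x \in E) => //=.
  have [xD|] := boolP (x \in D m) => //=; rewrite mem_set//.
  by move: xD; rewrite inE; have /subsetPset := ndD _ _ mq; exact.
have -> : (\int[mu]_(x in E) F x ^+ p.+1)%E = (\int[mu]_x limn (h^~ x))%E.
  rewrite integral_mkcond; apply: eq_integral => x _; apply/esym/cvg_lim => //.
  rewrite (_ : (_ \_ E) x = ereal_sup (range (h^~ x))).
    exact: (ereal_nondecreasing_cvgn (ndh x)).
  have [k0 _ Dk] : (\bigcup_k D k) x by rewrite -TD.
  have Dm m : (k0 <= m)%N -> x \in D m.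
    by move=> km; rewrite inE; have /subsetPset := ndD _ _ km; apply.
  rewrite patchE; case: ifPn => [Ex|/negP]; last first.
    rewrite inE => nEx; apply/eqP; rewrite eq_le; apply/andP; split.
      by apply: ereal_sup_ubound; exists 0%N => //; rewrite /h phiE// expr0n.
    by apply: ge_ereal_sup => _ [m _ <-]; rewrite /h phiE// expr0n.
  have phiEx m : (k0 <= m)%N -> phi m x = fine (mine (F x) m%:R%:E).
    by move=> /Dm xm; rewrite /phi indicE in_setI Ex xm mulr1.
  apply/eqP; rewrite eq_le; apply/andP; split; last first.
    apply: ge_ereal_sup => _ [m _ <-].
    by rewrite /h EFin_expe lee_expe2r// lee_fin.
  have [Fy|Fy] := eqVneq (F x) +oo%E.
    rewrite Fy (_ : +oo ^+ p.+1 = +oo)%E; last first.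
      by elim: (p) => [//|q IH]; rewrite expeS IH mulyy.
    rewrite leye_eq; apply/eqP/eqyP => r r0.
    pose m := maxn k0 (Num.bound r).+1.
    apply: (@le_trans _ _ (h m x)); last by apply: ereal_sup_ubound; exists m.
    have m1 : 1 <= m%:R :> R by rewrite ler1n leq_max orbT.
    rewrite lee_fin phiEx ?leq_maxl// Fy min_r ?leey//=.
    apply: (@le_trans _ _ m%:R); last by rewrite exprS ler_peMr// exprn_ege1.
    apply: (le_trans (ltW (archi_boundP (ltW r0)))).
    by rewrite ler_nat /m leq_max leqnSn orbT.
  have Ff : F x \is a fin_num by rewrite ge0_fin_numE// ltey.
  pose m := maxn k0 (Num.bound (fine (F x))).
  apply: ereal_sup_ubound; exists m => //.
  rewrite /h phiEx ?leq_maxl// min_l; first by rewrite EFin_expe fineK.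
  rewrite -[F x]fineK// lee_fin.
  apply: (le_trans (ltW (archi_boundP _))); first exact: fine_ge0.
  by rewrite ler_nat leq_maxr.
rewrite monotone_convergence//.
apply: lime_le; last exact: nearW.
apply: ereal_nondecreasing_is_cvgn => m q mq.
by apply: ge0_le_integral => // x _; exact: ndh.
Qed.

(** For phi <= F supported in E the integral S of phi^(2e+2) is at most the pairing
of phi^(2e+1) with F, so the assumed bound on the pairing is self-improving.
Truncation makes S finite, which is essential for absorbing it. *)
Lemma strong_from_duality d (X : measurableType d)
    (mu : {sigma_finite_measure set X -> \bar R}) (e : nat)
    (F : X -> \bar R) (E : set X) (N B : R) :
  measurable E -> measurable_fun setT F -> (forall x, 0 <= F x)%E ->
  0 <= N -> 0 <= B ->
  (forall (phi : X -> R) (S c del : R), measurable_fun setT phi ->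
    (forall x, 0 <= phi x) -> (forall x, ~ E x -> phi x = 0) ->
    (\int[mu]_x (phi x ^+ (2 * e).+2)%:E <= S%:E)%E -> 0 < c -> 0 < del ->
    (\int[mu]_x ((phi x ^+ (2 * e).+1)%:E * F x) <=
      (del * N / 2 + (c * S ^+ 2 + B * S / c ^+ e) / del)%:E)%E) ->
  (\int[mu]_(x in E) F x ^+ (2 * e).+2 <= (B * (4 * N) ^+ e.+1)%:E)%E.
Proof.
move=> mE mF F0 N0 B0 H; apply: lower_truncations => // phi S mphi phi0 phiE phiF phiS.
have S0 : 0 <= S.
  by rewrite -lee_fin -phiS integral_ge0// => x _; rewrite lee_fin exprn_ge0.
apply: self_improving_bound => // c del c0 del0; rewrite -lee_fin.
apply: le_trans (H phi S c del mphi phi0 phiE _ c0 del0); last by rewrite phiS.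
rewrite -phiS; apply: ge0_le_integral => //.
- by move=> x _; rewrite lee_fin exprn_ge0.
- by apply/measurable_EFinP; apply: measurable_funX.
- by apply: emeasurable_funM => //; apply/measurable_EFinP; apply: measurable_funX.
by move=> x _; rewrite exprSr EFinM lee_wpmul2l// lee_fin exprn_ge0.
Qed.
End duality.

(** * Slicing Lebesgue measure; volume-preserving isometries *)

Section cons_fubini.
Context {R : realType}.
Local Notation leb := (@lebesgue_measure R).
Local Notation lam := (lebesgue_euclidean R).

Lemma uncons_euclideanK n : cancel (@uncons_euclidean R n) cons_euclidean.
Proof. by move=> x; apply/esym; rewrite {1}(tuple_eta x); apply/val_inj. Qed.

Lemma dotp_cons n (p q : measurableTypeR R * euclidean R n) :
  dotp (cons_euclidean p) (cons_euclidean q) = (p.1 : R) * q.1 + dotp p.2 q.2.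
Proof.
rewrite /dotp big_ord_recl !tnth0; congr (_ + _).
by apply: eq_bigr => i _; rewrite !tnthS.
Qed.

Lemma dotpC n (x y : euclidean R n) : dotp x y = dotp y x.
Proof. by apply: eq_bigr => i _; rewrite mulrC. Qed.

Lemma dotpp_ge0 n (x : euclidean R n) : 0 <= dotp x x.
Proof. by apply: sumr_ge0 => i _; rewrite -expr2 sqr_ge0. Qed.

Lemma measurable_dotp n : measurable_fun setT
  (fun p : euclidean R n * euclidean R n => dotp p.1 p.2 : R).
Proof.
apply: measurable_sum => i.
apply: measurable_funM.
  exact: (measurableT_comp (measurable_coord i) measurable_fst).
exact: (measurableT_comp (measurable_coord i) measurable_snd).
Qed.

Lemma measurable_dotpl n (x : euclidean R n) :
  measurable_fun setT (fun w => dotp x w : R).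
Proof.
exact: (measurableT_comp (@measurable_dotp _)
  (measurable_fun_pair (@measurable_cst _ _ _ _ setT x) (@measurable_id _ _ setT))).
Qed.

Lemma lebesgue_consE n (A : set (euclidean R n.+1)) :
  lam n.+1 A = (leb \x lam n)%E (cons_euclidean @^-1` A).
Proof. by []. Qed.

Lemma measurable_cons_preimage n (A : set (euclidean R n.+1)) :
  measurable A -> measurable (cons_euclidean @^-1` A).
Proof.
by move=> mA; rewrite -[X in measurable X]setTI; exact: measurable_cons_euclidean.
Qed.

Lemma measurable_cons_section n (A : set (euclidean R n.+1)) u :
  measurable A -> measurable [set v | A (cons_euclidean (u, v))].
Proof.
move=> mA; have := measurable_xsection u (measurable_cons_preimage mA).
by rewrite xsectionE.
Qed.

Lemma lebesgue_cons_int1 n (A : set (euclidean R n.+1)) : measurable A ->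
  lam n.+1 A = (\int[leb]_u lam n [set v | A (cons_euclidean (u, v))])%E.
Proof.
move=> mA; rewrite lebesgue_consE /=; apply: eq_integral => u _ /=.
by rewrite xsectionE.
Qed.

Lemma lebesgue_cons_int2 n (A : set (euclidean R n.+1)) : measurable A ->
  lam n.+1 A = (\int[lam n]_v leb [set u | A (cons_euclidean (u, v))])%E.
Proof.
move=> mA; rewrite lebesgue_consE.
have -> : (leb \x lam n)%E (cons_euclidean @^-1` A) =
    (leb \x^ lam n)%E (cons_euclidean @^-1` A).
  apply: product_measure_unique; last exact: measurable_cons_preimage.
  by move=> B C mB mC; exact: (@product_measure2E _ _ _ _ _ leb (lam n)). 
by apply: eq_integral => u _ /=; rewrite ysectionE.
Qed.

Lemma lebesgue_cons_le1 n (A : set (euclidean R n.+1)) (U : set (measurableTypeR R))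
    (c : R) : measurable A -> measurable U -> 0 <= c ->
  (forall u v, A (cons_euclidean (u, v)) -> U u) ->
  (forall u, U u -> lam n [set v | A (cons_euclidean (u, v))] <= c%:E)%E ->
  (lam n.+1 A <= c%:E * leb U)%E.
Proof.
move=> mA mU c0 AU Ac; rewrite lebesgue_cons_int1//.
rewrite -[X in (_ <= _ * leb X)%E]setIT -integral_indic// -ge0_integralZl_EFin//; last first.
  by apply/measurable_EFinP; exact: measurable_indic.
apply: ge0_le_integral => //.
- rewrite (_ : (fun _ => _) = lam n \o xsection (cons_euclidean @^-1` A)).
    exact: measurable_fun_xsection (measurable_cons_preimage mA).
  by apply/funext => ? /=; rewrite xsectionE.
- by apply: emeasurable_funM => //; apply/measurable_EFinP; exact: measurable_indic.
move=> u _; rewrite indicE; have [uU|uU] := boolP (u \in U).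
  by rewrite mule1 Ac// -inE.
rewrite mule0 (_ : [set v | _] = set0) ?measure0//.
by apply/seteqP; split => v //= /AU; rewrite -in_setE (negbTE uU).
Qed.

Lemma lebesgue_cons_le2 n (A : set (euclidean R n.+1)) (V : set (euclidean R n))
    (c : R) : measurable A -> measurable V -> 0 <= c ->
  (forall u v, A (cons_euclidean (u, v)) -> V v) ->
  (forall v, V v -> leb [set u | A (cons_euclidean (u, v))] <= c%:E)%E ->
  (lam n.+1 A <= c%:E * lam n V)%E.
Proof.
move=> mA mV c0 AV Ac; rewrite lebesgue_cons_int2//.
rewrite -[X in (_ <= _ * lam n X)%E]setIT -integral_indic// -ge0_integralZl_EFin//; last first.
  by apply/measurable_EFinP; exact: measurable_indic.
apply: ge0_le_integral => //.
- rewrite (_ : (fun _ => _) = leb \o ysection (cons_euclidean @^-1` A)).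
    exact: measurable_fun_ysection (measurable_cons_preimage mA).
  by apply/funext => ? /=; rewrite ysectionE.
- by apply: emeasurable_funM => //; apply/measurable_EFinP; exact: measurable_indic.
move=> v _; rewrite indicE; have [vV|vV] := boolP (v \in V).
  by rewrite mule1 Ac// -inE.
rewrite mule0 (_ : [set u | _] = set0) ?measure0//.
by apply/seteqP; split => u //= /AV; rewrite -in_setE (negbTE vV).
Qed.

Lemma measurable_affine (a b : R) :
  measurable_fun setT (fun u : measurableTypeR R => a * u + b : measurableTypeR R).
Proof. by apply: measurable_funD => //; apply: measurable_funM. Qed.

(** The scaled push-forward of Lebesgue measure by the affine map has the right
value on intervals, hence is Lebesgue measure. *)
Lemma lebesgue_affine (a b : R) (A : set (measurableTypeR R)) : a != 0 -> measurable A ->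
  (leb [set u | A (a * u + b)%R] = `|a|^-1%:E * leb A)%E.
Proof.
move=> a0 mA; have na0 : 0 < `|a| by rewrite normr_gt0.
pose P : {measure set (measurableTypeR R) -> \bar R} := mscale (NngNum (normr_ge0 a))
  (measure_function_pushforward__canonical__measure_function_Measure leb (measurable_affine a b)).
have -> : leb A = P A.
  apply: lebesgue_measure_unique => // _ [[x y]] _ <-.
  transitivity (`|a|%:E * leb ((fun u : R => (a * u + b)%R) @^-1` `]x, y]%classic))%E; last by [].
  apply/esym.
  have -> : (fun u : R => a * u + b) @^-1` `]x, y]%classic =
      if 0 < a then `](x - b) / a, (y - b) / a]%classic
      else `[(y - b) / a, (x - b) / a[%classic.
    have [ap|an] := ltP 0 a; apply/seteqP; split => u /=; rewrite !in_itv/=.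
    - by rewrite ltr_pdivrMr// ler_pdivlMr// ltrBlDr lerBrDr mulrC.
    - by rewrite ltr_pdivrMr// ler_pdivlMr// ltrBlDr lerBrDr mulrC.
    - have ap : a < 0 by rewrite lt_neqAle a0.
      by rewrite ltr_ndivlMr// ler_ndivrMr// ltrBlDr lerBrDr mulrC andbC.
    - have ap : a < 0 by rewrite lt_neqAle a0.
      by rewrite ltr_ndivlMr// ler_ndivrMr// ltrBlDr lerBrDr mulrC andbC.
  have [ap|an] := ltP 0 a; rewrite !lebesgue_measure_itv/= !lte_fin.
    rewrite ltr_pM2r ?invr_gt0// ltrD2r; case: ifPn => // _; last by rewrite mule0.
    by rewrite -EFinB -EFinM -EFinB; congr EFin; rewrite gtr0_norm//; field; rewrite a0.
  have ap : a < 0 by rewrite lt_neqAle a0.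
  rewrite ltr_nM2r ?invr_lt0// ltrD2r; case: ifPn => // _; last by rewrite mule0.
  by rewrite -EFinB -EFinM -EFinB; congr EFin; rewrite ltr0_norm//; field; rewrite a0.
by rewrite /P /mscale /= muleA -EFinM mulVf ?mul1e// gt_eqF.
Qed.

Lemma integral_affine (a b : R) (f : measurableTypeR R -> \bar R) : a != 0 ->
  measurable_fun setT f -> (forall x, 0 <= f x)%E ->
  (\int[leb]_u f (a * u + b)%R = `|a|^-1%:E * \int[leb]_u f u)%E.
Proof.
move=> a0 mf f0.
have ia0 : 0 <= `|a|^-1 by rewrite invr_ge0.
have -> : (\int[leb]_u f (a * u + b)%R = \int[mscale (NngNum ia0) leb]_u f u)%E.
  have := @ge0_integral_pushforward _ _ _ _ _ _ (measurable_affine a b) leb setT f measurableT mf.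
  rewrite preimage_setT => <-.
  - apply: eq_measure_integral; first exact: measurable_affine.
    by move=> mab A mA _; exact: (lebesgue_affine b a0 mA).
  - by move=> y _; exact: f0.
by rewrite ge0_integral_mscale.
Qed.

End cons_fubini.

Section isometries.
Context {R : realType}.
Local Notation leb := (@lebesgue_measure R).
Local Notation lam := (lebesgue_euclidean R).

(** Preservation of the inner product is all that is used of orthogonality, so
linearity is not recorded. *)
Definition volume_isometry n (T : euclidean R n -> euclidean R n) :=
  [/\ measurable_fun setT T,
      forall x y, dotp (T x) (T y) = dotp x y &
      forall A, measurable A -> lam n (T @^-1` A) = lam n A].

Lemma cons_euclidean_surj n (x : euclidean R n.+1) :
  exists u v, x = cons_euclidean (u, v).
Proof.
by exists (uncons_euclidean x).1, (uncons_euclidean x).2;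
  rewrite -surjective_pairing uncons_euclideanK.
Qed.

Lemma volume_isometry_id n : @volume_isometry n id.
Proof. by split. Qed.

Lemma volume_isometry_comp n (T U : euclidean R n -> euclidean R n) :
  volume_isometry T -> volume_isometry U -> volume_isometry (T \o U).
Proof.
move=> [mT dT lT] [mU dU lU]; split.
- exact: measurableT_comp.
- by move=> x y /=; rewrite dT dU.
- move=> A mA; rewrite comp_preimage lU ?lT//.
  by rewrite -[X in measurable X]setTI; exact: mT.
Qed.

Definition lift_map n (T : euclidean R n -> euclidean R n) x :=
  cons_euclidean ((uncons_euclidean x).1, T (uncons_euclidean x).2).

Lemma lift_mapE n (T : euclidean R n -> euclidean R n) u v :
  lift_map T (cons_euclidean (u, v)) = cons_euclidean (u, T v).
Proof. by rewrite /lift_map cons_euclideanK. Qed.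

Lemma volume_isometry_lift n (T : euclidean R n -> euclidean R n) :
  volume_isometry T -> volume_isometry (lift_map T).
Proof.
move=> [mT dT lT].
have mL : measurable_fun setT (lift_map T).
  apply: (measurableT_comp measurable_cons_euclidean).
  apply: measurable_fun_pair.
    exact: (measurableT_comp measurable_fst measurable_uncons_euclidean).
  apply: (measurableT_comp mT).
  exact: (measurableT_comp measurable_snd measurable_uncons_euclidean).
split => // [x y|A mA].
  by rewrite -[in RHS](uncons_euclideanK x) -[in RHS](uncons_euclideanK y) !dotp_cons /= dT.
have mTA : measurable (lift_map T @^-1` A).
  by rewrite -[X in measurable X]setTI; exact: mL.
rewrite !lebesgue_cons_int1//; apply: eq_integral => u _.
rewrite -(lT _ (measurable_cons_section u mA)); congr (lam n _).
by apply/funext => v; exact: (congr1 A (lift_mapE T u v)).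
Qed.

Definition rotate2 n (c s : R) (x : euclidean R n.+2) : euclidean R n.+2 :=
  cons_euclidean (
    c * (uncons_euclidean x).1 + s * (uncons_euclidean (uncons_euclidean x).2).1,
    cons_euclidean (
      c * (uncons_euclidean (uncons_euclidean x).2).1 - s * (uncons_euclidean x).1,
      (uncons_euclidean (uncons_euclidean x).2).2)).

Lemma rotate2E n (c s : R) u v (w : euclidean R n) :
  rotate2 c s (cons_euclidean (u, cons_euclidean (v, w))) =
  cons_euclidean (c * u + s * v, cons_euclidean (c * v - s * u, w)).
Proof.
have gen x y : uncons_euclidean x = (u, y) -> uncons_euclidean y = (v, w) ->
  rotate2 c s x = cons_euclidean (c * u + s * v, cons_euclidean (c * v - s * u, w)).
  by move=> E1 E2; rewrite /rotate2 E1 E2.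
by apply: gen; exact: cons_euclideanK.
Qed.

(** For fixed u the first new coordinate a = c u + s v may replace v, and in terms
of it the second one is b = (c a - u) / s; then b may replace u.  The Jacobians
1 / |s| and |s| cancel. *)
Lemma volume_isometry_rotate2 n (c s : R) : s != 0 -> c ^+ 2 + s ^+ 2 = 1 ->
  volume_isometry (@rotate2 n c s).
Proof.
move=> s0 cs1.
have m1 : measurable_fun setT (fun x : euclidean R n.+2 => (uncons_euclidean x).1).
  exact: (measurableT_comp measurable_fst measurable_uncons_euclidean).
have mx : measurable_fun setT (fun x : euclidean R n.+2 => (uncons_euclidean x).2).
  exact: (measurableT_comp measurable_snd measurable_uncons_euclidean).
have m2 : measurable_fun setT (fun x : euclidean R n.+2 =>
    (uncons_euclidean (uncons_euclidean x).2).1).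
  by apply: (measurableT_comp measurable_fst); apply: measurableT_comp measurable_uncons_euclidean mx.
have m3 : measurable_fun setT (fun x : euclidean R n.+2 =>
    (uncons_euclidean (uncons_euclidean x).2).2).
  by apply: (measurableT_comp measurable_snd); apply: measurableT_comp measurable_uncons_euclidean mx.
have mR : measurable_fun setT (@rotate2 n c s).
  apply: (measurableT_comp measurable_cons_euclidean).
  apply: measurable_fun_pair.
    by apply: measurable_funD; apply: measurable_funM.
  apply: (measurableT_comp measurable_cons_euclidean).
  apply: measurable_fun_pair => //.
  by apply: measurable_funB; apply: measurable_funM.
split; [exact: mR|move=> x y|move=> A mA].
  have [u [x' ->]] := cons_euclidean_surj x; have [u' [x'' ->]] := cons_euclidean_surj x'.
  have [v [y' ->]] := cons_euclidean_surj y; have [v' [y'' ->]] := cons_euclidean_surj y'.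
  rewrite !rotate2E !dotp_cons /=.
  rewrite !addrA; congr (_ + _).
  transitivity ((c ^+ 2 + s ^+ 2) * (u * v + u' * v') : R); last by rewrite cs1 mul1r.
  by ring.
have mRA : measurable (@rotate2 n c s @^-1` A).
  by rewrite -[X in measurable X]setTI; exact: mR.
pose psi (p : measurableTypeR R * measurableTypeR R) : \bar R :=
  lam n [set w | A (cons_euclidean (p.1, cons_euclidean (p.2, w)))].
have mpsi : measurable_fun setT psi.
  pose A3 : set ((measurableTypeR R * measurableTypeR R) * euclidean R n) :=
    (fun q => cons_euclidean (q.1.1, cons_euclidean (q.1.2, q.2))) @^-1` A.
  have mA3 : measurable A3.
    rewrite -[X in measurable X]setTI.
    apply: (measurableT_comp measurable_cons_euclidean) => //.
    apply: measurable_fun_pair.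
      exact: (measurableT_comp measurable_fst measurable_fst).
    apply: (measurableT_comp measurable_cons_euclidean).
    apply: measurable_fun_pair => //.
    exact: (measurableT_comp measurable_snd measurable_fst).
  rewrite (_ : psi = lam n \o xsection A3); first exact: measurable_fun_xsection.
  by apply/funext => p; rewrite /= xsectionE.
have psi0 p : (0 <= psi p)%E by exact: measure_ge0.
have psiE (B : set (euclidean R n.+2)) : measurable B ->
    lam n.+2 B = (\int[leb]_u \int[leb]_v
      lam n [set w | B (cons_euclidean (u, cons_euclidean (v, w)))])%E.
  move=> mB; apply: (etrans (lebesgue_cons_int1 mB)); apply: eq_integral => u _.
  exact: (lebesgue_cons_int1 (measurable_cons_section u mB)).
apply: (etrans (psiE _ mRA)); apply: (etrans _ (esym (psiE _ mA))).
transitivity (\int[leb]_u \int[leb]_v psi (c * u + s * v, c * v - s * u)%R)%E.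
  apply: eq_integral => u _; apply: eq_integral => v _; rewrite /psi /=.
  by congr (lam n _); apply/funext => w; exact: (congr1 A (rotate2E c s u v w)).
(* the second new coordinate in terms of u and the first one *)
have E1 u v : psi (c * u + s * v, c * v - s * u)%R =
    psi (s * v + c * u, (- s^-1) * u + c / s * (s * v + c * u))%R.
  congr (psi (_, _)); first by rewrite addrC.
  have -> : c * v - s * u = c * v - (c ^+ 2 + s ^+ 2 - c ^+ 2) / s * u.
    by rewrite [c ^+ 2 + _]addrC addrK expr2 mulfK.
  by rewrite cs1; field.
under eq_integral do under eq_integral do rewrite E1.
have mpsi1 u : measurable_fun setT
    (fun a : measurableTypeR R => psi (a, (- s^-1) * u + c / s * a)).
  apply: (measurableT_comp mpsi); apply: measurable_fun_pair => //.
  by apply: measurable_funD => //; apply: measurable_funM.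
transitivity (\int[leb]_u (`|s|^-1%:E * \int[leb]_a psi (a, (- s^-1) * u + c / s * a)%R))%E.
  apply: eq_integral => u _.
  exact: (integral_affine (c * u) s0 (mpsi1 u)).
have mpsi2 : measurable_fun setT (fun p : measurableTypeR R * measurableTypeR R =>
    psi (p.2, (- s^-1) * p.1 + c / s * p.2)).
  apply: (measurableT_comp mpsi); apply: measurable_fun_pair => //.
  by apply: measurable_funD => //; apply: measurable_funM.
rewrite ge0_integralZl_EFin//; last 2 first.
- by move=> u _; apply: integral_ge0.
- exact: (measurable_fun_fubini_tonelli_F (fun p : measurableTypeR R * measurableTypeR R => psi (p.2, (- s^-1) * p.1 + c / s * p.2)%R)).
rewrite (fubini_tonelli (fun p : measurableTypeR R * measurableTypeR R => psi (p.2, (- s^-1) * p.1 + c / s * p.2)%R))//=.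
rewrite -ge0_integralZl_EFin//; last 2 first.
- by move=> u _; apply: integral_ge0.
- exact: (measurable_fun_fubini_tonelli_G (fun p : measurableTypeR R * measurableTypeR R => psi (p.2, (- s^-1) * p.1 + c / s * p.2)%R)).
apply: eq_integral => a _.
have s0' : - s^-1 != 0 by rewrite oppr_eq0 invr_eq0.
have mpsi3 : measurable_fun setT (fun b : measurableTypeR R => psi (a, b)).
  exact: measurableT_comp.
rewrite (integral_affine (c / s * a) s0' mpsi3)//.
by rewrite muleA -EFinM normrN normfV invrK mulVf ?mul1e// normr_eq0.
Qed.

Definition axis n (t : R) : euclidean R n.+1 :=
  cons_euclidean (t, [tuple of nseq n 0]).

Lemma dotp0l n (y : euclidean R n) : dotp ([tuple of nseq n 0] : euclidean R n) y = 0.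
Proof. by apply: big1 => i _; rewrite tnth_nseq mul0r. Qed.

Lemma dotp_axis n t u (v : euclidean R n) :
  dotp (axis n t) (cons_euclidean (u, v)) = t * u.
Proof. by rewrite dotp_cons /= dotp0l addr0. Qed.

(** By induction the tail of x can be rotated to an axis; a rotation of the first
two coordinates then removes the only remaining entry.  The sign of t is left
free. *)
Lemma rotate_to_axis n (x : euclidean R n.+1) :
  exists T, volume_isometry T /\ exists t, T x = axis n t.
Proof.
elim: n x => [|n IH] x.
  exists id; split; first exact: volume_isometry_id.
  exists (thead x); rewrite -[LHS]uncons_euclideanK; congr (cons_euclidean (_, _)).
  by rewrite tuple0 [RHS]tuple0.
have [T [isoT [t Tx']]] := IH (uncons_euclidean x).2.
set u : R := (uncons_euclidean x).1.
have Lx : lift_map T x = cons_euclidean (u, axis n t) by rewrite /lift_map Tx'.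
have isoL := volume_isometry_lift isoT.
(* rotate2 needs a nonzero sine *)
have [t0|t0] := eqVneq t 0.
  exists (lift_map T); split => //; exists u; rewrite Lx t0.
  by congr (cons_euclidean (_, _)); apply/val_inj.
pose r := Num.sqrt (u ^+ 2 + t ^+ 2).
have rp : 0 < r.
  by rewrite sqrtr_gt0 ltr_wpDl// ?sqr_ge0// exprn_even_gt0.
have r2 : r ^+ 2 = u ^+ 2 + t ^+ 2 by rewrite sqr_sqrtr// addr_ge0// sqr_ge0.
have r0 : r != 0 by rewrite gt_eqF.
exists (@rotate2 n (u / r) (t / r) \o lift_map T); split.
  apply: (volume_isometry_comp _ isoL); apply: volume_isometry_rotate2.
    by rewrite mulf_neq0// invr_eq0.
  by rewrite !expr_div_n -mulrDl -r2 mulfV// expf_neq0.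
exists r; rewrite /= Lx rotate2E.
have -> : u / r * u + t / r * t = r.
  rewrite (_ : _ + _ = (u ^+ 2 + t ^+ 2) / r); last by field.
  by rewrite -r2 expr2 mulfK.
have -> : u / r * t - t / r * u = 0 by ring.
by congr (cons_euclidean (_, _)); apply/val_inj.
Qed.

End isometries.

(** * Volumes of shells, slabs and sectors *)

Section shells.
Context {R : realType}.
Local Notation leb := (@lebesgue_measure R).
Local Notation lam := (lebesgue_euclidean R).

Definition scale_euclidean n (r : R) (x : euclidean R n) : euclidean R n :=
  [tuple r * (tnth x i : R) | i < n].

Lemma scale_cons n r u (v : euclidean R n) :
  scale_euclidean r (cons_euclidean (u, v)) =
  cons_euclidean (r * u, scale_euclidean r v).
Proof.
apply: eq_from_tnth => i; rewrite tnth_mktuple.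
by case: (unliftP ord0 i) => [j ->|->]; rewrite ?tnthS ?tnth0 ?tnth_mktuple.
Qed.

Lemma dotp_scale n r (x : euclidean R n) :
  dotp (scale_euclidean r x) (scale_euclidean r x) = r ^+ 2 * dotp x x.
Proof.
rewrite /dotp mulr_sumr; apply: eq_bigr => i _.
by rewrite tnth_mktuple mulrACA -expr2.
Qed.

Lemma measurable_scale n r : measurable_fun setT (@scale_euclidean n r).
Proof.
apply/measurable_fun_tnthP => i.
have -> : (@tnth n (measurableTypeR R))^~ i \o scale_euclidean r =
    (fun x : euclidean R n => r * (tnth x i : R)).
  by apply/funext => x; rewrite /= tnth_mktuple.
by apply: measurable_funM => //; exact: measurable_coord.
Qed.

Lemma lebesgue_scale n (r : R) (A : set (euclidean R n)) : 0 < r -> measurable A ->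
  (lam n (scale_euclidean r @^-1` A) = (r ^- n)%:E * lam n A)%E.
Proof.
move=> r0; elim: n A => [|n IH] A mA.
  rewrite expr0 invr1 mul1e; congr (lam 0 _).
  by apply/funext => x; congr (A _); rewrite [LHS]tuple0 [RHS]tuple0.
have mS : measurable (@scale_euclidean n.+1 r @^-1` A).
  by rewrite -[X in measurable X]setTI; exact: measurable_scale.
rewrite !lebesgue_cons_int1//.
pose f (u : measurableTypeR R) := lam n [set v | A (cons_euclidean (u, v))].
have mf : measurable_fun setT f.
  rewrite (_ : f = lam n \o xsection (cons_euclidean @^-1` A)).
    exact: measurable_fun_xsection (measurable_cons_preimage mA).
  by apply/funext => ? /=; rewrite xsectionE.
have rn0 : r != 0 by rewrite gt_eqF.
transitivity (\int[leb]_u ((r ^- n)%:E * f (r * u + 0)%R))%E.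
  apply: eq_integral => u _; rewrite addr0 /f -IH; last exact: measurable_cons_section.
  by congr (lam n _); apply/funext => v; exact: (congr1 A (scale_cons r u v)).
rewrite ge0_integralZl_EFin//; last 2 first.
- by apply: (measurableT_comp mf); exact: measurable_affine.
- by rewrite invr_ge0 exprn_ge0// ltW.
rewrite (integral_affine 0 rn0 mf)//.
by rewrite muleA -EFinM gtr0_norm// -invfM -exprSr.
Qed.

Definition sqball n (t : R) : set (euclidean R n) := [set x | dotp x x <= t].

Lemma measurable_dotpp n : measurable_fun setT (fun x : euclidean R n => dotp x x : R).
Proof.
exact: (measurableT_comp (@measurable_dotp R n)
  (measurable_fun_pair (@measurable_id _ _ setT) (@measurable_id _ _ setT))).
Qed.

Lemma measurable_sqball n t : measurable (@sqball n t).
Proof.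
rewrite (_ : sqball t = (fun x : euclidean R n => dotp x x : R) @^-1` `]-oo, t]); last first.
  by apply/seteqP; split=> x /=; rewrite in_itv.
by rewrite -[X in measurable X]setTI; exact: measurable_dotpp.
Qed.

Definition shell n (a b : R) : set (euclidean R n) :=
  [set x | [/\ dotp x x <= 1, a <= dotp x x & dotp x x <= b]].

Lemma measurable_shell n a b : measurable (@shell n a b).
Proof.
rewrite (_ : shell a b = sqball 1 `&` (fun x : euclidean R n => dotp x x : R) @^-1` `[a, b]); last first.
  apply/seteqP; split=> x /=; rewrite in_itv/=.
    by move=> [h1 h2 h3]; split=> //; exact/andP.
  by move=> [x1 /andP[]].
apply: measurableI; first exact: measurable_sqball.
by rewrite -[X in measurable X]setTI; exact: measurable_dotpp.
Qed.

Lemma lebesgue_itvNr (r : R) : 0 <= r -> leb `[(- r), r]%classic = (2 * r)%:E.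
Proof.
move=> r0; rewrite lebesgue_measure_itv/= lte_fin; case: ltP => rr.
  by rewrite -EFinB; congr EFin; ring.
by have -> : r = 0 by [lra]; rewrite mulr0.
Qed.

Lemma itv_of_sqr (u s : R) : 0 <= s -> u * u + s <= 1 -> - 1 <= u <= 1.
Proof. by move=> s0 us; nra. Qed.

Lemma lebesgue_unit_sqball n : (lam n (sqball 1) <= (2 ^+ n)%:E)%E.
Proof.
elim: n => [|n IH].
  by rewrite expr0 /= diracE lee_fin; case: (_ \in _); rewrite //= ler01.
rewrite exprSr EFinM -[2%R in X in (_ * X)%E]mulr1 -(@lebesgue_itvNr 1)//.
apply: lebesgue_cons_le1 => //.
- exact: measurable_sqball.
- move=> u v; rewrite /sqball /= dotp_cons /= in_itv /=.
  by apply: itv_of_sqr; exact: dotpp_ge0.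
- move=> u _; apply: le_trans IH; apply: le_measure; rewrite ?inE.
  + exact: (measurable_cons_section u (@measurable_sqball n.+1 1)).
  + exact: measurable_sqball.
  + move=> v; rewrite /sqball /= dotp_cons /=; apply: le_trans.
    by rewrite lerDr -expr2 sqr_ge0.
Qed.

Lemma lebesgue_sqball n t : 0 < t ->
  (lam n.*2 (sqball t) = (t ^+ n)%:E * lam n.*2 (sqball 1))%E.
Proof.
move=> t0; pose r := (Num.sqrt t)^-1; have r0 : 0 < r by rewrite invr_gt0 sqrtr_gt0.
have r2 : r ^+ 2 = t^-1 by rewrite exprVn sqr_sqrtr// ltW.
have := lebesgue_scale r0 (@measurable_sqball n.*2 1).
have -> : @scale_euclidean n.*2 r @^-1` sqball 1 = sqball t.
  apply/seteqP; split => x; rewrite /sqball /preimage /= dotp_scale r2 mulrC;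
  by rewrite ler_pdivrMr// mul1r.
by rewrite -mul2n exprM r2 exprVn invrK.
Qed.

(** The area of a disc is proportional to the square of its radius, so the area of
a shell is proportional to its thickness in the squared radius.  The closed
shell is enclosed in a half-open one of thickness 2 D, or in a disc. *)
Lemma lebesgue_shell2 a D : 0 < D ->
  (lam 2 (shell a (a + D)) <= (8 * D)%:E)%E.
Proof.
move=> D0; pose k := lam 2 (sqball 1).
have k4 : (k <= 4%:E)%E.
  by apply: (le_trans (lebesgue_unit_sqball 2)); rewrite lee_fin expr2; lra.
have k0 : (0 <= k)%E by exact: measure_ge0.
have kf : k \is a fin_num by rewrite ge0_fin_numE// (le_lt_trans k4)// ltry.
have kE t : 0 < t -> (lam 2 (sqball t) = (t * fine k)%:E)%E.
  by move=> t0; rewrite (@lebesgue_sqball 1 t t0) expr1 EFinM fineK.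
have k4' : fine k <= 4 by rewrite -lee_fin fineK.
have le8 : 2 * D * fine k <= 8 * D by nra.
have [aD|Da] := leP a D.
  apply: (@le_trans _ _ (lam 2 (sqball (2 * D)))).
    apply: le_measure; rewrite ?inE; [exact: measurable_shell|exact: measurable_sqball|].
    by move=> x [_ _ xb]; apply: (le_trans xb); lra.
  by rewrite kE ?mulr_gt0// lee_fin.
have aD0 : 0 < a - D by rewrite subr_gt0.
have aDp : 0 < a + D by lra.
apply: (@le_trans _ _ (lam 2 (sqball (a + D) `\` sqball (a - D)))).
  apply: le_measure; rewrite ?inE; [exact: measurable_shell| |].
    by apply: measurableD; exact: measurable_sqball.
  by move=> x [_ ax xb]; split => //=; rewrite /sqball /=; lra.
have fin t : 0 < t -> (lam 2 (sqball t) < +oo)%E by move=> t0; rewrite kE ?ltry.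
rewrite measureD; [|exact: measurable_sqball|exact: measurable_sqball|exact: fin].
rewrite (setIidr _); last by move=> x; rewrite /sqball /=; lra.
suff : (lam 2 (sqball (a + D)) - lam 2 (sqball (a - D)) <= (8 * D)%:E)%E by [].
rewrite !kE// -EFinB lee_fin; apply: le_trans le8.
by rewrite le_eqVlt; apply/orP; left; apply/eqP; ring.
Qed.

(** Fixing one coordinate of a point of a shell leaves a shell of the same
thickness one dimension lower, so the plane case gives all others. *)
Lemma lebesgue_shell n a D : 0 < D ->
  (lam n.+2 (shell a (a + D)) <= (8 * 2 ^+ n * D)%:E)%E.
Proof.
move=> D0; elim: n a => [|n IH] a.
  by rewrite expr0 mulr1; exact: lebesgue_shell2.
have -> : 8 * 2 ^+ n.+1 * D = (8 * 2 ^+ n * D) * (2 * 1) by rewrite exprS; ring.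
rewrite EFinM -(@lebesgue_itvNr 1)//.
apply: lebesgue_cons_le1 => //.
- exact: measurable_shell.
- by rewrite mulr_ge0 ?(ltW D0)// mulr_ge0// exprn_ge0.
- move=> u v [+ _ _]; rewrite dotp_cons /= in_itv /=.
  by apply: itv_of_sqr; exact: dotpp_ge0.
- move=> u _; apply: le_trans (IH (a - u * u)); apply: le_measure; rewrite ?inE.
  + exact: (measurable_cons_section u (@measurable_shell _ _ _)).
  + exact: measurable_shell.
  + move=> v []; rewrite /= dotp_cons /= => h1 h2 h3; split.
    * by apply: le_trans h1; rewrite lerDr -expr2 sqr_ge0.
    * by rewrite lerBlDl.
    * by rewrite addrAC lerBrDl.
Qed.

Lemma measurable_slab n c e (x : euclidean R n) :
  measurable [set w | `|c + dotp x w| <= e].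
Proof.
rewrite (_ : [set w | _] = (fun w => `|c + dotp x w| : R) @^-1` `]-oo, e]); last first.
  by apply/seteqP; split=> w /=; rewrite in_itv.
rewrite -[X in measurable X]setTI.
apply: (@measurableT_comp _ _ _ _ _ _ (@Num.norm R R)) => //.
by apply: measurable_funD => //; exact: measurable_dotpl.
Qed.

Lemma lebesgue_affine_itv (t c e : R) : t != 0 -> 0 <= e ->
  measurable [set u : measurableTypeR R | `|t * u + c| <= e] /\
  (leb [set u : measurableTypeR R | (`|t * u + c| <= e)%R] = (2 * e / `|t|)%:E)%E.
Proof.
move=> t0 e0.
have E : [set u : measurableTypeR R | `|t * u + c| <= e] =
    (fun u : measurableTypeR R => t * u + c : measurableTypeR R) @^-1` `[(- e), e].
  by apply/seteqP; split => u /=; rewrite in_itv /= -ler_norml.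
rewrite E; split.
  by rewrite -[X in measurable X]setTI; apply: measurable_affine => //; exact: measurable_itv.
have := lebesgue_affine c t0 (measurable_itv `[(- e), e]).
by rewrite lebesgue_itvNr// -EFinM mulrC.
Qed.

(** Rotate v to an axis: the slab constrains the first coordinate to an interval
of length 2 e / |v|, and the remaining coordinates lie in a shell of the same
thickness. *)
Lemma lebesgue_shell_slab n (K a D c e : R) (v : euclidean R n.+1) :
  0 <= K -> 0 <= e -> (forall a, lam n (shell a (a + D)) <= K%:E)%E ->
  0 < dotp v v ->
  (lam n.+1 (shell a (a + D) `&` [set w | (`|c + dotp v w| <= e)%R]) <=
     (K * (2 * e / enorm v))%:E)%E.
Proof.
move=> K0 e0 HK v0.
have [T [[mT dT lT] [t Tv]]] := rotate_to_axis v.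
have t2 : t ^+ 2 = dotp v v.
  by rewrite -dT Tv dotp_axis expr2.
have nt : `|t| = enorm v by rewrite /enorm -t2 sqrtr_sqr.
have t0 : t != 0 by rewrite -sqrf_eq0 t2 gt_eqF.
pose A := shell a (a + D) `&` [set w : euclidean R n.+1 | `|c + dotp (axis n t) w| <= e].
have mA : measurable A by apply: measurableI; [exact: measurable_shell|exact: measurable_slab].
have -> : shell a (a + D) `&` [set w | (`|c + dotp v w| <= e)%R] = T @^-1` A.
  by apply/funext => w; rewrite /A /shell /preimage /setI /= -Tv !dT.
rewrite lT// -nt; have [mU leU] := lebesgue_affine_itv c t0 e0.
rewrite EFinM -leU; apply: lebesgue_cons_le1 => //.
- by move=> u w [_] /=; rewrite dotp_axis /= addrC.
- move=> u _; apply: le_trans (HK (a - u * u)); apply: le_measure; rewrite ?inE.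
  + exact: (measurable_cons_section u mA).
  + exact: measurable_shell.
  + move=> w [[]]; rewrite /= dotp_cons /= => h1 h2 h3 _; split.
    * by apply: le_trans h1; rewrite lerDr -expr2 sqr_ge0.
    * by rewrite lerBlDl.
    * by rewrite addrAC lerBrDl.
Qed.
End shells.

(** * The regularised kernel of the adjoint transform *)

Section cylinder.
Context {R : realType} {n : nat}.

(** A name for the measure of the cylinder, so that its sigma-finiteness can be
attached to it. *)
Definition cyl : set (measurableTypeR R * euclidean R n)%type -> \bar R :=
  cylinder_measure R n.

HB.instance Definition _ := Measure.on cyl.

Lemma sigma_finite_cyl : sigma_finite setT cyl.
Proof.
exact: (isSigmaFinite.sigma_finiteT
  (lebesgue_integral_fubini.measure_function_Measure_isSigmaFinite__to__measure_function_isSigmaFinite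
    (@lebesgue_measure R) (surface_measure R n))).
Qed.

HB.instance Definition _ := Measure_isSigmaFinite.Build _ _ _ cyl sigma_finite_cyl.

Lemma integral_cyl f : (\int[cyl]_z f z = \int[cylinder_measure R n]_z f z)%E.
Proof. by []. Qed.

End cylinder.
Arguments cyl : clear implicits.

Section kernel.
Context {R : realType}.
Local Notation leb := (@lebesgue_measure R).
Local Notation lam := (lebesgue_euclidean R).

(** The kernel of the adjoint transform, regularised at scale eps: integrating it
against G amounts to averaging G over the window |s - x . w| < eps within
[a, b]. *)
Definition band n (eps a b : R)
    (q : euclidean R n * (measurableTypeR R * euclidean R n)) : R :=
  (2 * eps)^-1 * ((`|(q.2.1 : R) - dotp q.1 q.2.2| < eps)%R%:R *
                  (a <= (q.2.1 : R) <= b)%R%:R).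

Lemma band_ge0 n eps a b q : 0 <= eps -> 0 <= @band n eps a b q.
Proof. by move=> e0; rewrite mulr_ge0 ?invr_ge0 ?mulr_ge0. Qed.

Lemma measurable_band n eps a b : measurable_fun setT (@band n eps a b).
Proof.
have ms : measurable_fun setT (fun q : euclidean R n * (measurableTypeR R * euclidean R n) => q.2.1 : R).
  exact: (measurableT_comp measurable_fst measurable_snd).
have mw : measurable_fun setT (fun q : euclidean R n * (measurableTypeR R * euclidean R n) => q.2.2).
  exact: (measurableT_comp measurable_snd measurable_snd).
apply: measurable_funM => //; apply: measurable_funM; apply: measurable_bool_natr.
  apply: measurable_fun_ltr => //.
  apply: (@measurableT_comp _ _ _ _ _ _ (@Num.norm R R)) => //.
  apply: measurable_funB => //.
  exact: (measurableT_comp (@measurable_dotp R n) (measurable_fun_pair measurable_fst mw)).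
by apply: measurable_and; apply: measurable_fun_ler.
Qed.

Definition directions n (eps a b : R) (x y : euclidean R n) : set (euclidean R n) :=
  [set w | a - eps <= dotp x w <= b + eps /\ `|dotp x w - dotp y w| <= 2 * eps].

Lemma measurable_directions n eps a b x y : measurable (@directions n eps a b x y).
Proof.
have -> : directions eps a b x y =
    (fun w => dotp x w : R) @^-1` `[a - eps, b + eps] `&`
    (fun w => `|dotp x w - dotp y w| : R) @^-1` `]-oo, 2 * eps].
  by apply/seteqP; split=> w; rewrite /directions /= !in_itv/=.
apply: measurableI; rewrite -[X in measurable X]setTI; first exact: measurable_dotpl.
apply: (@measurableT_comp _ _ _ _ _ _ (@Num.norm R R)) => //.
by apply: measurable_funB; exact: measurable_dotpl.
Qed.

(** A direction contributes only if the windows around x . w and y . w meet each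
other and [a, b]; the integral in s over such a window is then at most
2 eps * (2 eps)^-2. *)
Lemma kernel_le_directions n eps a b (x y : euclidean R n) : 0 < eps ->
  (\int[cyl R n]_z (band eps a b (x, z) * band eps a b (y, z))%:E <=
   ((2 * eps)^-1)%:E * surface_measure R n (directions eps a b x y))%E.
Proof.
move=> e0; have e0' := ltW e0.
have mbx x0 : measurable_fun setT (fun z => @band n eps a b (x0, z)).
  by apply: (measurableT_comp (measurable_band eps a b)); exact: pair1_measurable.
rewrite integral_cyl.
rewrite (fubini_tonelli2 (fun z => (band eps a b (x, z) * band eps a b (y, z))%:E)); last 2 first.
- by apply/measurable_EFinP; apply: measurable_funM.
- by move=> z; rewrite lee_fin mulr_ge0// band_ge0.
have mO := measurable_directions eps a b x y.
rewrite -(setIT (directions eps a b x y)) -(integral_indic (surface_measure R n) measurableT mO).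
rewrite -ge0_integralZl_EFin//; last 2 first.
- by apply/measurable_EFinP; exact: measurable_indic.
- by rewrite invr_ge0 mulr_ge0.
apply: ge0_le_integral => //.
- by move=> w _; apply: integral_ge0 => s _; rewrite lee_fin mulr_ge0// band_ge0.
- apply: (measurable_fun_fubini_tonelli_G (fun z => (band eps a b (x, z) * band eps a b (y, z))%:E)).
    by apply/measurable_EFinP; apply: measurable_funM.
  by move=> z; rewrite lee_fin mulr_ge0// band_ge0.
- by apply: emeasurable_funM => //; apply/measurable_EFinP; exact: measurable_indic.
move=> w _; rewrite /fubini_G indicE; case: (boolP (w \in _)) => [wO|wO] /=; last first.
  rewrite mule0 le_eqVlt; apply/orP; left; apply/eqP; apply: integral0_eq => s _.
  rewrite /band /=; case: (ltP `|s - dotp x w| eps) => [sx|]; last by rewrite !(mul0r, mulr0).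
  case: (ltP `|s - dotp y w| eps) => [sy|]; last by rewrite !(mul0r, mulr0).
  case: (boolP (a <= s <= b)) => [/andP[as_ sb]|]; last by rewrite !(mul0r, mulr0).
  exfalso; move/negP: wO; apply; rewrite inE; split.
    by move: sx; rewrite ltr_norml => /andP[s1 s2]; apply/andP; split; lra.
  rewrite (_ : _ - _ = (s - dotp y w) - (s - dotp x w)); last by ring.
  apply: (le_trans (ler_normB _ _)); lra.
rewrite mule1.
apply: (@le_trans _ _ (\int[leb]_s (((2 * eps)^-1 ^+ 2)%:E * (\1_(ball (dotp x w : R) eps) s)%:E))%E).
  apply: ge0_le_integral => //.
  - by move=> s _; rewrite lee_fin mulr_ge0// band_ge0.
  - apply/measurable_EFinP; apply: measurable_funM.
      by apply: (measurableT_comp (mbx x)); exact: pair2_measurable.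
    by apply: (measurableT_comp (mbx y)); exact: pair2_measurable.
  - apply: emeasurable_funM => //; apply/measurable_EFinP; apply: measurable_indic.
    exact: measurable_ball.
  move=> s _; have -> : \1_(ball (dotp x w : R) eps) s = (`|s - dotp x w| < eps)%R%:R :> R.
    by rewrite indicE; congr (_%:R); congr nat_of_bool; apply/idP/idP; rewrite inE /ball /= distrC.
  rewrite -EFinM lee_fin /band /=.
  rewrite expr2 -mulrA; set i := (2 * eps)^-1.
  have i0 : 0 <= i by rewrite invr_ge0 mulr_ge0.
  rewrite -!mulrA ler_wpM2l//.
  case: (`|s - dotp x w| < eps); last by rewrite !(mul0r, mulr0).
  case: (a <= s <= b); rewrite ?(mul0r, mulr0, mulr1, mul1r) ?i0//.
  by rewrite ler_piMr//; case: (_ < _).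
rewrite ge0_integralZl_EFin//; last 2 first.
- by apply/measurable_EFinP; apply: measurable_indic; exact: measurable_ball.
- by rewrite exprn_ge0// invr_ge0 mulr_ge0.
rewrite integral_indic ?setIT//; last exact: measurable_ball.
have E : leb (ball (dotp x w : R) eps) = (eps *+ 2)%:E by exact: lebesgue_measure_ball.
rewrite [X in (_ * X)%E](_ : _ = (eps *+ 2)%:E)//.
rewrite -EFinM lee_fin expr2 -mulrA.
by rewrite -[eps *+ 2]mulr_natl mulVf ?mulr1// mulf_neq0// gt_eqF.
Qed.

(** The surface measure is defined through the cone over a set of directions; for
w in this cone the constraints on the direction of w become homogeneous in w. *)
Lemma cone_memP n eps a b (x y w : euclidean R n) :
  (direction @^-1` directions eps a b x y `&` punctured_ball) w ->
  [/\ 0 < enorm w, dotp w w <= 1,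
     (a - eps) * enorm w <= dotp x w <= (b + eps) * enorm w &
     `|dotp x w - dotp y w| <= 2 * eps * enorm w].
Proof.
move=> [[/andP[xa xb] xy] /andP[w0 w1]].
have dE z : dotp z (direction w) = dotp z w / enorm w.
  rewrite /dotp mulr_suml; apply: eq_bigr => i _.
  by rewrite tnth_mktuple mulrCA mulrC.
move: xa xb xy; rewrite !dE -mulrBl normrM [`|_^-1|]gtr0_norm ?invr_gt0//.
rewrite ler_pdivlMr// !ler_pdivrMr// => xa xb xy; split => //; last by rewrite xa xb.
have : enorm w ^+ 2 <= 1 by rewrite exprn_ile1// enorm_ge0.
by rewrite /enorm sqr_sqrtr// dotpp_ge0.
Qed.

Lemma measurable_cone n eps a b (x y : euclidean R n) :
  measurable (direction @^-1` directions eps a b x y `&` punctured_ball).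
Proof.
apply: measurableI; last exact: measurable_punctured_ball.
rewrite -[X in measurable X]setTI; apply: measurable_direction => //.
exact: measurable_directions.
Qed.

End kernel.

Section weak_type.
Context {R : realType}.
Local Notation leb := (@lebesgue_measure R).
Local Notation lam := (lebesgue_euclidean R).

Lemma lebesgue_sqball_le n (P : R) : 0 < P -> (lam n (sqball (P ^+ 2)) <= ((2 * P) ^+ n)%:E)%E.
Proof.
move=> P0; have iP0 : 0 < P^-1 by rewrite invr_gt0.
have := lebesgue_scale iP0 (@measurable_sqball R n 1).
have -> : @scale_euclidean R n P^-1 @^-1` sqball 1 = sqball (P ^+ 2).
  apply/seteqP; split => x; rewrite /sqball /preimage /= dotp_scale exprVn mulrC;
  by rewrite ler_pdivrMr ?exprn_gt0// mul1r.
move=> ->; rewrite exprVn invrK exprMn mulrC EFinM lee_wpmul2l//.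
  by rewrite lee_fin exprn_ge0// ltW.
exact: lebesgue_unit_sqball.
Qed.

Definition cylinder_set n (c h P : R) : set (euclidean R n.+1) :=
  [set y | `|(uncons_euclidean y).1 - c| <= h /\ sqball (P ^+ 2) (uncons_euclidean y).2].
Arguments cylinder_set : clear implicits.

Lemma lebesgue_cylinder n (c h P : R) : 0 <= h -> 0 < P ->
  measurable (cylinder_set n c h P) /\
  (lam n.+1 (cylinder_set n c h P) <= (2 * h * (2 * P) ^+ n)%:E)%E.
Proof.
move=> h0 P0; have [mU leU] := lebesgue_affine_itv (- c) (oner_neq0 R) h0.
have mC : measurable (cylinder_set n c h P).
  have -> : cylinder_set n c h P = uncons_euclidean @^-1`
      ([set u : measurableTypeR R | `|1 * u + - c| <= h] `*` sqball (P ^+ 2)).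
    by apply/seteqP; split => y; rewrite /cylinder_set /preimage /setX /= mul1r.
  rewrite -[X in measurable X]setTI; apply: measurable_uncons_euclidean => //.
  by apply: measurableX => //; exact: measurable_sqball.
split => //.
have -> : 2 * h * (2 * P) ^+ n = (2 * P) ^+ n * (2 * h / `|1|) by rewrite normr1 divr1 mulrC.
have P20 : 0 <= (2 * P) ^+ n by rewrite exprn_ge0// mulr_ge0// ltW.
rewrite EFinM -leU; apply: lebesgue_cons_le1 => //.
- move=> u v; rewrite /cylinder_set /mkset cons_euclideanK => -[+ _].
  by rewrite mul1r.
- move=> u _; apply: le_trans (lebesgue_sqball_le n P0); apply: le_measure; rewrite ?inE.
  + exact: (measurable_cons_section u mC).
  + exact: measurable_sqball.
  + by move=> v; rewrite /cylinder_set /mkset cons_euclideanK => -[].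
Qed.

(** The first coordinate u of w ranges over an interval of length 2 b / |t|.  For
fixed u the first entry of y only shifts the slab constraint, so the remaining
coordinates lie in a shell cut by a slab orthogonal to y'.  The conditions with
al say that |w|^2 is determined up to D by x . w. *)
Lemma sector_volume n (A : set (euclidean R n.+2)) (K D al b e t y1 : R) (y' : euclidean R n.+1) :
  measurable A -> 0 <= K -> 0 <= b -> 0 <= e -> t != 0 -> 0 < dotp y' y' ->
  (forall a, lam n (shell a (a + D)) <= K%:E)%E ->
  (forall w, A w -> let s := dotp (axis n.+1 t) w in
     [/\ dotp w w <= 1, `|s| <= b, al * s ^+ 2 <= dotp w w, dotp w w <= al * s ^+ 2 + D &
         `|s - dotp (cons_euclidean (y1, y')) w| <= e]) ->
  (lam n.+2 A <= (K * (2 * e / enorm y') * (2 * b / `|t|))%:E)%E.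
Proof.
move=> mA K0 b0 e0 t0 y0 HK HA; have [mU leU] := lebesgue_affine_itv 0 t0 b0.
have K20 : 0 <= K * (2 * e / enorm y').
  by rewrite mulr_ge0// divr_ge0 ?enorm_ge0// mulr_ge0.
rewrite EFinM -leU; apply: lebesgue_cons_le1 => //.
- by move=> u v /HA[_ + _ _ _] /=; rewrite dotp_axis addr0.
- move=> u _.
  apply: le_trans (lebesgue_shell_slab (al * (t * u) ^+ 2 - u * u) ((y1 - t) * u) K0 e0 HK y0).
  apply: le_measure; rewrite ?inE.
  + exact: (measurable_cons_section u mA).
  + by apply: measurableI; [exact: measurable_shell|exact: measurable_slab].
  + move=> v /HA; rewrite /= !dotp_cons /= dotp0l addr0 => -[h1 _ h3 h4 h5]; split.
      split => /=.
      * by apply: le_trans h1; rewrite lerDr -expr2 sqr_ge0.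
      * by rewrite lerBlDl.
      * by rewrite addrAC lerBrDl.
    rewrite /mkset (_ : _ + _ = - (t * u - (y1 * u + dotp y' v))); last by ring.
    by rewrite normrN.
Qed.

(** The bound without the slab constraint of [sector_volume]; here the shell has
one more dimension. *)
Lemma sector_volume0 n (A : set (euclidean R n.+1)) (K D al b t : R) :
  measurable A -> 0 <= K -> 0 <= b -> t != 0 ->
  (forall a, lam n (shell a (a + D)) <= K%:E)%E ->
  (forall w, A w -> let s := dotp (axis n t) w in
     [/\ dotp w w <= 1, `|s| <= b, al * s ^+ 2 <= dotp w w & dotp w w <= al * s ^+ 2 + D]) ->
  (lam n.+1 A <= (K * (2 * b / `|t|))%:E)%E.
Proof.
move=> mA K0 b0 t0 HK HA; have [mU leU] := lebesgue_affine_itv 0 t0 b0.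
rewrite EFinM -leU; apply: lebesgue_cons_le1 => //.
- by move=> u v /HA[_ + _ _] /=; rewrite dotp_axis addr0.
- move=> u _; apply: le_trans (HK (al * (t * u) ^+ 2 - u * u)).
  apply: le_measure; rewrite ?inE.
  + exact: (measurable_cons_section u mA).
  + exact: measurable_shell.
  + move=> v /HA; rewrite /= !dotp_cons /= dotp0l addr0 => -[h1 _ h3 h4]; split.
    * by apply: le_trans h1; rewrite lerDr -expr2 sqr_ge0.
    * by rewrite lerBlDl.
    * by rewrite addrAC lerBrDl.
Qed.

(** For fixed remaining coordinates of w the first one lies in an interval of
length 2 e / |y1 - t|. *)
Lemma slab_volume n (A : set (euclidean R n.+1)) (e t y1 : R) (y' : euclidean R n) :
  measurable A -> 0 <= e -> y1 != t ->
  (forall w, A w ->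
     dotp w w <= 1 /\ `|dotp (axis n t) w - dotp (cons_euclidean (y1, y')) w| <= e) ->
  (lam n.+1 A <= (2 * e / `|y1 - t| * 2 ^+ n)%:E)%E.
Proof.
move=> mA e0 yt HA; have yt0 : y1 - t != 0 by rewrite subr_eq0.
have c0 : 0 <= 2 * e / `|y1 - t| by rewrite divr_ge0// mulr_ge0.
apply: (@le_trans _ _ ((2 * e / `|y1 - t|)%:E * lam n (sqball 1))%E); last first.
  by rewrite [leRHS]EFinM lee_wpmul2l// lebesgue_unit_sqball.
apply: lebesgue_cons_le2 => //.
- exact: measurable_sqball.
- move=> u v /HA[+ _]; rewrite dotp_cons /sqball /=; apply: le_trans.
  by rewrite lerDr -expr2 sqr_ge0.
- move=> v _; have [mU <-] := lebesgue_affine_itv (dotp y' v) yt0 e0.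
  apply: le_measure; rewrite ?inE//.
    by have := measurable_ysection v (measurable_cons_preimage mA); rewrite ysectionE.
  move=> u /HA[_]; rewrite /mkset !dotp_cons /= dotp0l addr0.
  by rewrite (_ : t * u - _ = - ((y1 - t) * u + dotp y' v)) ?normrN//; ring.
Qed.

Definition coneset n (eps a b : R) (x y : euclidean R n) : set (euclidean R n) :=
  [set w | [/\ 0 < enorm w, dotp w w <= 1,
     (a - eps) * enorm w <= dotp x w <= (b + eps) * enorm w &
     `|dotp x w - dotp y w| <= 2 * eps * enorm w]].

Lemma measurable_set_le n (f g : euclidean R n -> R) :
  measurable_fun setT f -> measurable_fun setT g -> measurable [set x | f x <= g x].
Proof.
move=> mf mg; have := measurable_fun_ler mf mg => /(_ measurableT [set true]).
by rewrite setTI; apply.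
Qed.

Lemma measurable_coneset n eps a b x y : measurable (@coneset n eps a b x y).
Proof.
have mx := measurable_dotpl x; have my := measurable_dotpl y.
have me := @measurable_enorm R n.
have -> : coneset eps a b x y = (enorm @^-1` `]0, +oo[) `&` sqball 1 `&`
   [set w | (a - eps) * enorm w <= dotp x w] `&` [set w | dotp x w <= (b + eps) * enorm w]
   `&` [set w | `|dotp x w - dotp y w| <= 2 * eps * enorm w].
  apply/seteqP; split=> w; rewrite /coneset /= in_itv/= andbT.
    by move=> [h1 h2 /andP[h3 h4] h5].
  by move=> [[[[h1 h2] h3] h4] h5]; split => //; rewrite h3 h4.
repeat apply: measurableI.
- by rewrite -[X in measurable X]setTI; exact: me.
- exact: measurable_sqball.
- by apply: measurable_set_le => //; apply: measurable_funM.
- by apply: measurable_set_le => //; apply: measurable_funM.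
- apply: measurable_set_le; last by apply: measurable_funM.
  apply: (@measurableT_comp _ _ _ _ _ _ (@Num.norm R R)) => //.
  exact: measurable_funB.
Qed.

Lemma kernel_le_cone n eps a b (x y : euclidean R n) T : 0 < eps -> volume_isometry T ->
  (\int[cyl R n]_z (band eps a b (x, z) * band eps a b (y, z))%:E <=
   (n%:R / (2 * eps))%:E * lam n (coneset eps a b (T x) (T y)))%E.
Proof.
move=> e0 [mT dT lT]; apply: (le_trans (kernel_le_directions _ _ _ _ e0)).
rewrite [n%:R / _]mulrC EFinM -muleA lee_wpmul2l ?lee_fin ?invr_ge0 ?mulr_ge0 ?(ltW e0)//.
apply: (@lee_wpmul2l _ n%:R%:E); rewrite ?lee_fin//.
rewrite -(lT _ (measurable_coneset eps a b (T x) (T y))).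
have -> : T @^-1` coneset eps a b (T x) (T y) = coneset eps a b x y.
  by apply/funext => w; rewrite /coneset /preimage /mkset /enorm !dT.
apply: le_measure; rewrite ?inE; [exact: measurable_cone|exact: measurable_coneset|].
by move=> w /cone_memP.
Qed.

Lemma measurable_kernel_gt n eps a b (x : euclidean R n) l : 0 < eps ->
  measurable [set y | l%:E < \int[cyl R n]_z
     (band eps a b (x, z) * band eps a b (y, z))%:E]%E.
Proof.
move=> e0.
pose f (q : euclidean R n * (measurableTypeR R * euclidean R n)) :=
  (band eps a b (x, q.2) * band eps a b q)%:E.
have mf : measurable_fun setT f.
  apply/measurable_EFinP; apply: measurable_funM; last exact: measurable_band.
  apply: (measurableT_comp (measurable_band eps a b)).
  exact: measurable_fun_pair (measurable_cst x) measurable_snd.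
have f0 q : (0 <= f q)%E by rewrite lee_fin mulr_ge0// band_ge0// ltW.
have mF := @measurable_fun_fubini_tonelli_F _ _ _ _ R
  (cyl R n) f mf f0.
by have := emeasurable_fun_o_infty measurableT mF l%:E; rewrite setTI.
Qed.

(** After the rotation of x to an axis, a set of y on which the kernel is large is
contained in a cylinder around the axis as soon as this holds for the volumes
of cones. *)
Lemma weak_type_from_cone n eps a b (x : euclidean R n.+1) T t (l h P : R) :
  0 < eps -> volume_isometry T -> T x = axis n t -> 0 <= h -> 0 < P ->
  (forall y1 (y' : euclidean R n),
    (l%:E < (n.+1%:R / (2 * eps))%:E *
      lam n.+1 (coneset eps a b (axis n t) (cons_euclidean (y1, y'))))%E ->
    `|y1 - t| <= h /\ dotp y' y' <= P ^+ 2) ->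
  (lam n.+1 [set y | l%:E < \int[cyl R n.+1]_z
     (band eps a b (x, z) * band eps a b (y, z))%:E] <= (2 * h * (2 * P) ^+ n)%:E)%E.
Proof.
move=> e0 isoT Tx h0 P0 H; have [mC leC] := lebesgue_cylinder n t h0 P0.
apply: le_trans leC; have [mT dT lT] := isoT; rewrite -(lT _ mC).
apply: le_measure; rewrite ?inE.
- exact (measurable_kernel_gt a b x l e0).
- by rewrite -[X in measurable X]setTI; exact: mT.
move=> y /= ly; rewrite /cylinder_set /preimage /mkset.
have [y1 [y' Ty]] := cons_euclidean_surj (T y); rewrite Ty cons_euclideanK; apply: H.
by rewrite -Tx -Ty; apply: (lt_le_trans ly); exact: kernel_le_cone.
Qed.

End weak_type.
Arguments cylinder_set : clear implicits.

(** * Weak-type bounds for the regularised kernel *)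

Section weak_bounds.
Context {R : realType}.
Local Notation lam := (lebesgue_euclidean R).

Lemma sqr_enorm n (x : euclidean R n) : enorm x ^+ 2 = dotp x x.
Proof. by rewrite /enorm sqr_sqrtr// dotpp_ge0. Qed.

Lemma enorm_axis n t : enorm (axis n t : euclidean R n.+1) = `|t|.
Proof. by rewrite /enorm dotp_axis -expr2 sqrtr_sqr. Qed.

Lemma volume_isometry_enorm n (T : euclidean R n -> euclidean R n) x :
  volume_isometry T -> enorm (T x) = enorm x.
Proof. by move=> [_ dT _]; rewrite /enorm dT. Qed.

(** The Cauchy-Schwarz inequality, read off after rotating x to an axis. *)
Lemma dotp_le_enorm n (x y : euclidean R n.+1) : `|dotp x y| <= enorm x * enorm y.
Proof.
have [T [isoT [t Tx]]] := rotate_to_axis x; have [_ dT _] := isoT.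
rewrite -(volume_isometry_enorm x isoT) -(volume_isometry_enorm y isoT) -dT Tx.
have [u [v ->]] := cons_euclidean_surj (T y).
rewrite dotp_axis enorm_axis normrM ler_wpM2l// -sqrtr_sqr /enorm ler_wsqrtr//.
by rewrite dotp_cons /= -expr2 lerDl dotpp_ge0.
Qed.

(** Two bounds for the volume of the cone are combined.  The slab bound gives
|y1 - t| <= C0 / l; the sector bound, where the shell is the whole unit ball
(al = 0, D = 1), gives |y'| <= C0 b / (l r). *)
Lemma weak_type_symmetric n (eps b l : R) (x : euclidean R n.+2) :
  0 < eps -> eps <= b -> 0 < enorm x -> 0 < l ->
  (lam n.+2 [set y | l%:E < \int[cyl R n.+2]_z
     (band eps (- b) b (x, z) * band eps (- b) b (y, z))%:E] <=
   ((2 * (n.+2%:R * 2 ^+ n.+3)) ^+ n.+2 * (b / enorm x) ^+ n.+1 / l ^+ n.+2)%:E)%E.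
Proof.
move=> e0 eb x0 l0; have b0 : 0 < b by apply: lt_le_trans eb.
have [T [isoT [t Tx]]] := rotate_to_axis x.
have rt : enorm x = `|t| by rewrite -(volume_isometry_enorm x isoT) Tx enorm_axis.
have t0 : t != 0 by rewrite -normr_gt0 -rt.
set C0 := n.+2%:R * 2 ^+ n.+3.
have C00 : 0 < C0 by rewrite mulr_gt0// exprn_gt0.
pose h := C0 / l; pose P := C0 * b / (l * enorm x).
have h0 : 0 <= h by rewrite divr_ge0// ltW.
have P0 : 0 < P by rewrite divr_gt0// mulr_gt0.
have -> : (2 * C0) ^+ n.+2 * (b / enorm x) ^+ n.+1 / l ^+ n.+2 = 2 * h * (2 * P) ^+ n.+1.
  have -> : 2 * P = (2 * C0) * (b / enorm x) / l by rewrite /P; field; rewrite !gt_eqF.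
  have -> : (2 * C0 * (b / enorm x) / l) ^+ n.+1 =
      (2 * C0) ^+ n.+1 * (b / enorm x) ^+ n.+1 / l ^+ n.+1.
    by rewrite expr_div_n [in LHS]exprMn.
  rewrite (exprS (2 * C0) n.+1) (exprS l n.+1) /h.
  have : l ^+ n.+1 != 0 by rewrite gt_eqF// exprn_gt0.
  move: (l ^+ n.+1) ((2 * C0) ^+ n.+1) ((b / enorm x) ^+ n.+1) => L M N L0.
  by field; rewrite L0 gt_eqF.
apply: (weak_type_from_cone e0 isoT Tx h0 P0) => y1 y'.
set A := coneset _ _ _ _ _ => lA.
have mA : measurable A by exact: measurable_coneset.
have HA w : A w -> [/\ dotp w w <= 1, `|dotp (axis n.+1 t) w| <= 2 * b &
     `|dotp (axis n.+1 t) w - dotp (cons_euclidean (y1, y')) w| <= 2 * eps].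
  move=> [w0 w1 /andP[xa xb] xy].
  have ew1 : enorm w <= 1.
    by rewrite -(@ler_pXn2r _ 2) ?nnegrE ?enorm_ge0// sqr_enorm expr1n.
  split => //; first by rewrite ler_norml; apply/andP; split; nra.
  by apply: (le_trans xy); nra.
have e20 : 0 <= 2 * eps by rewrite mulr_ge0// ltW.
have q0 : 0 <= n.+2%:R / (2 * eps) by rewrite divr_ge0.
split.
  have [->|yt] := eqVneq y1 t; first by rewrite subrr normr0.
  have yt0 : 0 < `|y1 - t| by rewrite normr_gt0 subr_eq0.
  have := slab_volume mA e20 yt (fun w Aw => let: And3 h1 _ h3 := HA w Aw in conj h1 h3).
  move=> /(lee_wpmul2l _) -/(_ (n.+2%:R / (2 * eps))%:E).
  rewrite lee_fin q0 => /(_ isT) /(lt_le_trans lA); rewrite -EFinM lte_fin.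
  have -> : n.+2%:R / (2 * eps) * (2 * (2 * eps) / `|y1 - t| * 2 ^+ n.+1) =
    n.+2%:R * 2 ^+ n.+2 / `|y1 - t| :> R by rewrite (exprS _ n.+1); field; rewrite !gt_eqF.
  rewrite ltr_pdivlMr// -ltr_pdivlMl// => /ltW lt1; apply: (le_trans lt1).
  rewrite /h mulrC ler_wpM2r ?invr_ge0 ?(ltW l0)// /C0 ler_wpM2l//.
  by rewrite ler_weXn2l// ler1n.
have [y0|y0] := leP (dotp y' y') 0; first by apply: (le_trans y0); rewrite exprn_ge0// ltW.
have ny0 : 0 < enorm y' by rewrite /enorm sqrtr_gt0.
have K0 : 0 <= 2 ^+ n :> R by rewrite exprn_ge0.
have HK a : (lam n (shell a (a + 1)) <= (2 ^+ n)%:E)%E.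
  apply: le_trans (lebesgue_unit_sqball n); apply: le_measure; rewrite ?inE.
  - exact: measurable_shell.
  - exact: measurable_sqball.
  - by move=> w [].
have b20 : 0 <= 2 * b by rewrite mulr_ge0// ltW.
have sec w : A w -> let s := dotp (axis n.+1 t) w in
    [/\ dotp w w <= 1, `|s| <= 2 * b, 0 * s ^+ 2 <= dotp w w, dotp w w <= 0 * s ^+ 2 + 1 &
        `|s - dotp (cons_euclidean (y1, y')) w| <= 2 * eps].
  by move=> /HA[h1 h2 h3]; split; rewrite ?mul0r ?dotpp_ge0 ?add0r.
have := sector_volume mA K0 b20 e20 t0 y0 HK sec.
rewrite -sqr_enorm ler_pXn2r ?nnegrE ?enorm_ge0 ?(ltW P0)//.
move=> /(lee_wpmul2l _) -/(_ (n.+2%:R / (2 * eps))%:E).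
rewrite lee_fin q0 => /(_ isT) /(lt_le_trans lA); rewrite -EFinM lte_fin.
have -> : n.+2%:R / (2 * eps) * (2 ^+ n * (2 * (2 * eps) / enorm y') * (2 * (2 * b) / `|t|)) =
    (C0 * b / `|t|) / enorm y' :> R.
  by rewrite /C0 !exprS; field; rewrite !gt_eqF// -rt.
rewrite ltr_pdivlMr// -ltr_pdivlMl// => /ltW; rewrite /P rt.
by rewrite invfM mulrA [l^-1 * _]mulrC [_ / `|t|]mulrAC -!mulrA [_^-1 * _^-1]mulrC.
Qed.
End weak_bounds.

Section weak_annulus.
Context {R : realType}.
Local Notation lam := (lebesgue_euclidean R).

(** With W = |w|, the cone condition bounds W^2 between s^2 / (b + eps)^2 and
s^2 / (a - eps)^2; as W <= 1 the gap between these is at most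
1 - (a - eps)^2 / (b + eps)^2. *)
Lemma shell_of_cone (a b eps s W : R) : 0 < a -> a < b -> 0 < eps ->
  eps <= a / 2 -> eps <= b - a -> 0 < W -> W ^+ 2 <= 1 ->
  (a - eps) * W <= s -> s <= (b + eps) * W ->
  [/\ `|s| <= 2 * b, (b + eps) ^- 2 * s ^+ 2 <= W ^+ 2 &
      W ^+ 2 <= (b + eps) ^- 2 * s ^+ 2 + 6 * (b - a) / a].
Proof.
move=> a0 ab e0 ea eb W0 W21 s1 s2.
have W1 : W <= 1 by nra.
have s0 : 0 <= s by apply: le_trans s1; rewrite mulr_ge0 ?(ltW W0)//; lra.
have B0 : 0 < b + eps by lra.
have A0 : 0 < a - eps by lra.
have B20 : 0 < (b + eps) ^+ 2 by rewrite exprn_gt0.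
split.
- by rewrite ger0_norm//; nra.
- rewrite mulrC ler_pdivrMr// -exprMn lerXn2r ?nnegrE//; last by rewrite mulrC.
  by rewrite mulr_ge0// ltW.
have h1 : (a - eps) ^+ 2 * W ^+ 2 <= s ^+ 2.
  by rewrite -exprMn lerXn2r ?nnegrE// mulr_ge0// ltW.
have h2 : (a - eps) ^+ 2 / (b + eps) ^+ 2 * W ^+ 2 <= (b + eps) ^- 2 * s ^+ 2.
  by rewrite mulrAC [leRHS]mulrC ler_wpM2r// invr_ge0 ltW.
rewrite -lerBlDl; apply: (@le_trans _ _ (1 - (a - eps) ^+ 2 / (b + eps) ^+ 2)).
  apply: (@le_trans _ _ ((1 - (a - eps) ^+ 2 / (b + eps) ^+ 2) * W ^+ 2)).
    by rewrite mulrBl mul1r lerB.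
  rewrite ler_piMr// subr_ge0 ler_pdivrMr// mul1r lerXn2r ?nnegrE ?(ltW A0) ?(ltW B0)//; lra.
have -> : 1 - (a - eps) ^+ 2 / (b + eps) ^+ 2 =
    (b - a + 2 * eps) * (b + a) / (b + eps) ^+ 2.
  by field; rewrite gt_eqF.
rewrite ler_pdivrMr// mulrAC ler_pdivlMr//.
apply: (@le_trans _ _ (3 * (b - a) * (2 * b) * a)).
  rewrite ler_pM2r// ler_pM//; lra.
have -> : 3 * (b - a) * (2 * b) * a = 6 * (b - a) * (b * a) by ring.
apply: ler_wpM2l; first by rewrite mulr_ge0//; lra.
rewrite expr2; nra.
Qed.

Lemma exprn_fraction (c p l t : R) k : (2 * (c * p / (l * t))) ^+ k =
  2 ^+ k * (c ^+ k * p ^+ k / (l ^+ k * t ^+ k)).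
Proof. by rewrite exprMn expr_div_n !exprMn. Qed.

Definition annulus_kernel_constant (m : nat) (kap : R) : R :=
  384 * m.+4%:R * 2 ^+ m * kap.

Lemma annulus_kernel_constant_gt0 m kap : 0 < kap ->
  0 < annulus_kernel_constant m kap.
Proof.
move=> k0; have p2 : 0 < 2 ^+ m :> R by exact: exprn_gt0.
exact: (mulr_gt0 (mulr_gt0 (mulr_gt0 (ltr0Sn R _) (ltr0Sn R _)) p2) k0).
Qed.

(** The sector bounds confine both |y'| and eps to at most P, and the existence of a
point in the cone confines y1 to |y1 - t| <= (2 eps + |y'|) * 2 r / a.  If the
cones of all y are empty the set has measure 0; otherwise r >= a / 2. *)
Lemma weak_type_annulus m (kap a b eps l : R) (x : euclidean R m.+4) :
  0 < a -> a < b -> b <= kap * a -> 0 < eps -> eps <= a / 2 -> eps <= b - a -> 0 < l ->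
  let C0 := annulus_kernel_constant m kap in
  lam m.+4 [set y | l%:E < \int[cyl R m.+4]_z
     (band eps a b (x, z) * band eps a b (y, z))%:E]%E = 0%E \/
  (a / 2 <= enorm x /\
  (lam m.+4 [set y | l%:E < \int[cyl R m.+4]_z
     (band eps a b (x, z) * band eps a b (y, z))%:E] <=
   (12 * 2 ^+ m.+3 * C0 ^+ m.+4 * ((b - a) ^+ m.+4 / (a * enorm x ^+ m.+3))
      / l ^+ m.+4)%:E)%E).
Proof.
move=> a0 ab bk e0 ea eb l0 C0.
have b0 : 0 < b by lra.
have kap0 : 0 < kap by rewrite -(pmulr_lgt0 _ a0); lra.
have C00 : 0 < C0 by exact: annulus_kernel_constant_gt0.
have [T [isoT [t Tx]]] := rotate_to_axis x.
have rt : enorm x = `|t| by rewrite -(volume_isometry_enorm x isoT) Tx enorm_axis.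
have q0 : 0 < m.+4%:R / (2 * eps) by rewrite divr_gt0// mulr_gt0.
have e20 : 0 <= 2 * eps by rewrite mulr_ge0// ltW.
(* w in the cone has a |w| / 2 <= |x . w| <= |t| |u|, so that dividing the slab
   constraint by |u| bounds y1 - t *)
have cone w y1 (y' : euclidean R m.+3) :
    coneset eps a b (axis m.+3 t) (cons_euclidean (y1, y')) w ->
    a / 2 <= `|t| /\ `|y1 - t| * (a / 2) <= (2 * eps + enorm y') * `|t|.
  have [u [v ->]] := cons_euclidean_surj w => -[].
  set w' := cons_euclidean (u, v).
  have E1 : dotp (axis m.+3 t) w' = t * u by exact: dotp_axis.
  have E2 : dotp (cons_euclidean (y1, y')) w' = y1 * u + dotp y' v by exact: dotp_cons.
  rewrite E1 E2 => w0 w1 /andP[tu1 tu2] uv.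
  have tu : (a / 2) * enorm w' <= `|t| * `|u|.
    rewrite -normrM; apply: (le_trans _ (ler_norm _)); apply: le_trans tu1.
    by rewrite ler_wpM2r ?(ltW w0)//; lra.
  have uw : `|u| <= enorm w'.
    rewrite -sqrtr_sqr /enorm ler_wsqrtr// dotp_cons /= -expr2 lerDl.
    exact: dotpp_ge0.
  have vw : enorm v <= enorm w'.
    by rewrite /enorm ler_wsqrtr// dotp_cons /= lerDr -expr2 sqr_ge0.
  have t0 : 0 <= `|t| by [].
  have u0 : 0 <= `|u| by [].
  split.
    have : (a / 2) * enorm w' <= `|t| * enorm w' by apply: (le_trans tu); rewrite ler_wpM2l.
    by rewrite ler_pM2r.
  have h1 : `|y1 - t| * `|u| <= (2 * eps + enorm y') * enorm w'.
    rewrite -normrM (_ : (y1 - t) * u = - (t * u - (y1 * u + dotp y' v)) - dotp y' v); last by ring.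
    apply: (le_trans (ler_normB _ _)); rewrite normrN mulrDl lerD//.
    by apply: (le_trans (dotp_le_enorm _ _)); rewrite ler_wpM2l// enorm_ge0.
  rewrite -(ler_pM2r w0) -mulrA; apply: (@le_trans _ _ (`|y1 - t| * (`|t| * `|u|))).
    by rewrite ler_wpM2l.
  by rewrite mulrCA mulrC [leRHS]mulrAC ler_wpM2r.
set S := [set y | _]; have [/eqP S0|Sn0] := boolP (lam m.+4 S == 0%E); [by left|right].
(* a nonzero measure provides a y whose cone is not empty *)
have tpos : a / 2 <= `|t|.
  have : exists y1 (y' : euclidean R m.+3) w,
     coneset eps a b (axis m.+3 t) (cons_euclidean (y1, y')) w.
    apply: contrapT => nex; move/negP: Sn0; apply; apply/eqP.
    rewrite (_ : S = set0) ?measure0//; apply/seteqP; split => y //= ly; apply: nex.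
    have [y1 [y' Ty]] := cons_euclidean_surj (T y); exists y1, y'.
    apply: contrapT => nw; have := lt_le_trans ly (kernel_le_cone a b x y e0 isoT).
    rewrite Tx Ty (_ : coneset _ _ _ _ _ = set0) ?measure0 ?mule0 ?lte_fin.
      by move=> /lt_trans/(_ l0); rewrite ltxx.
    by apply/seteqP; split => w //= cw; apply: nw; exists w.
  by move=> [y1 [y' [w /cone[]]]].
split; first by rewrite rt.
have nt0 : 0 < `|t| by apply: lt_le_trans tpos; lra.
have t0 : t != 0 by rewrite -normr_gt0.
pose P := C0 * (b - a) / (l * `|t|); pose h := 6 * P * `|t| / a.
have ba0 : 0 < b - a by rewrite subr_gt0.
have P0 : 0 < P by apply: divr_gt0; apply: mulr_gt0.
have h0 : 0 <= h.
  by apply: divr_ge0; [apply: mulr_ge0 => //; apply: mulr_ge0 => //; exact: ltW|exact: ltW].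
have -> : 12 * 2 ^+ m.+3 * C0 ^+ m.+4 * ((b - a) ^+ m.+4 / (a * enorm x ^+ m.+3)) / l ^+ m.+4
    = 2 * h * (2 * P) ^+ m.+3.
  rewrite rt /h (_ : 6 * P * `|t| / a = 6 * (C0 * (b - a) / l) / a); last first.
    by rewrite /P; field; rewrite normr_eq0 t0 !gt_eqF.
  rewrite (_ : (2 * P) ^+ m.+3 = 2 ^+ m.+3 * (C0 ^+ m.+3 * (b - a) ^+ m.+3 /
    (l ^+ m.+3 * `|t| ^+ m.+3))); last exact: exprn_fraction.
  rewrite (exprS C0 m.+3) (exprS (b - a) m.+3) (exprS l m.+3).
  have : l ^+ m.+3 != 0 by rewrite gt_eqF// exprn_gt0.
  have : `|t| ^+ m.+3 != 0 by rewrite gt_eqF// exprn_gt0.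
  move: (l ^+ m.+3) (`|t| ^+ m.+3) (C0 ^+ m.+3) ((b - a) ^+ m.+3) (2 ^+ m.+3) => L t' C B p T'0 L0.
  by field; rewrite L0 T'0 !gt_eqF.
have D0 : 0 < 6 * (b - a) / a by rewrite divr_gt0// mulr_gt0.
pose D := 6 * (b - a) / a; pose K := 8 * 2 ^+ m * D; pose K1 := 8 * 2 ^+ m.+1 * D.
have K0 : 0 <= K by rewrite mulr_ge0 ?(ltW D0)// mulr_ge0// exprn_ge0.
have K10 : 0 <= K1 by rewrite mulr_ge0 ?(ltW D0)// mulr_ge0// exprn_ge0.
have b20 : 0 <= 2 * b by lra.
apply: (weak_type_from_cone e0 isoT Tx h0 P0) => y1 y'.
set A := coneset _ _ _ _ _ => lA.
have mA : measurable A by exact: measurable_coneset.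
have sec w : A w -> let s := dotp (axis m.+3 t) w in
    [/\ dotp w w <= 1, `|s| <= 2 * b, (b + eps) ^- 2 * s ^+ 2 <= dotp w w,
        dotp w w <= (b + eps) ^- 2 * s ^+ 2 + D &
        `|s - dotp (cons_euclidean (y1, y')) w| <= 2 * eps].
  move=> [w0 w1 /andP[xa xb] xy] /=.
  have w21 : enorm w ^+ 2 <= 1 by rewrite sqr_enorm.
  have ew1 : enorm w <= 1.
    by rewrite -(@ler_pXn2r _ 2) ?nnegrE ?enorm_ge0// sqr_enorm expr1n.
  have := shell_of_cone a0 ab e0 ea eb w0 w21 xa xb; rewrite sqr_enorm => -[h1 h2 h3].
  by split => //; apply: (le_trans xy); nra.
have sec0 w : A w -> let s := dotp (axis m.+3 t) w in
    [/\ dotp w w <= 1, `|s| <= 2 * b, (b + eps) ^- 2 * s ^+ 2 <= dotp w w &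
        dotp w w <= (b + eps) ^- 2 * s ^+ 2 + D] by move=> /sec[].
have ba_le : b / a <= kap by rewrite ler_pdivrMr.
have m20 : 0 < 2 ^+ m :> R by rewrite exprn_gt0.
have q1 : 0 <= 384 * m.+4%:R * 2 ^+ m * (b - a) :> R.
  by apply: mulr_ge0 (ltW ba0); apply: mulr_ge0 (ltW m20); exact: mulr_ge0.
have C0E : 384 * m.+4%:R * 2 ^+ m * (b - a) * (b / a) <= C0 * (b - a).
  by rewrite /C0 /annulus_kernel_constant [leRHS]mulrAC ler_wpM2l.
have leps : eps <= P.
  have := sector_volume0 mA K10 b20 t0 (fun a => lebesgue_shell m.+1 a D0) sec0.
  move=> /(lee_wpmul2l _) -/(_ (m.+4%:R / (2 * eps))%:E).
  rewrite lee_fin (ltW q0) => /(_ isT) /(lt_le_trans lA); rewrite -EFinM lte_fin.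
  have -> : m.+4%:R / (2 * eps) * (K1 * (2 * (2 * b) / `|t|)) =
      (384 * m.+4%:R * 2 ^+ m * (b - a) * (b / a)) / 2 / (eps * `|t|) :> R.
    by rewrite /K1 /D (exprS 2 m); field; rewrite normr_eq0 t0 !gt_eqF.
  rewrite ltr_pdivlMr ?mulr_gt0// => l1.
  rewrite /P ler_pdivlMr ?mulr_gt0// mulrCA; apply: (le_trans (ltW l1)).
  have q2 : 0 <= 384 * m.+4%:R * 2 ^+ m * (b - a) * (b / a).
    by apply: mulr_ge0 => //; apply: divr_ge0; exact: ltW.
  by apply: le_trans C0E; rewrite ler_piMr//; lra.
have lrho : dotp y' y' <= P ^+ 2.
  have [y0|y0] := leP (dotp y' y') 0; first by apply: (le_trans y0); rewrite exprn_ge0// ltW.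
  have ny0 : 0 < enorm y' by rewrite /enorm sqrtr_gt0.
  have := sector_volume mA K0 b20 e20 t0 y0 (fun a => lebesgue_shell m a D0) sec.
  rewrite -sqr_enorm ler_pXn2r ?nnegrE ?enorm_ge0 ?(ltW P0)//.
  move=> /(lee_wpmul2l _) -/(_ (m.+4%:R / (2 * eps))%:E).
  rewrite lee_fin (ltW q0) => /(_ isT) /(lt_le_trans lA); rewrite -EFinM lte_fin.
  have -> : m.+4%:R / (2 * eps) * (K * (2 * (2 * eps) / enorm y') * (2 * (2 * b) / `|t|)) =
      (384 * m.+4%:R * 2 ^+ m * (b - a) * (b / a)) / (enorm y' * `|t|) :> R.
    by rewrite /K /D; field; rewrite normr_eq0 t0 !gt_eqF.
  rewrite ltr_pdivlMr ?mulr_gt0// => l1.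
  by rewrite /P ler_pdivlMr ?mulr_gt0// mulrCA; apply: (le_trans (ltW l1)).
split => //.
have rhoP : enorm y' <= P.
  by rewrite -(@ler_pXn2r _ 2) ?nnegrE ?enorm_ge0 ?(ltW P0)// sqr_enorm.
have [w Aw] : exists w, A w.
  apply: contrapT => nA; move: lA; rewrite (_ : A = set0) ?measure0 ?mule0 ?lte_fin.
    by move=> /lt_trans/(_ l0); rewrite ltxx.
  by apply/seteqP; split => w //= Aw; apply: nA; exists w.
have [_ hh] := cone _ _ _ Aw.
rewrite /h ler_pdivlMr//.
have : (2 * eps + enorm y') * `|t| <= 3 * P * `|t| by rewrite ler_wpM2r//; lra.
by move: hh; nra.
Qed.
End weak_annulus.

(** * Removing the regularisation *)

Section almost_everywhere_facts.
Context {R : realType}.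
Local Notation leb := (@lebesgue_measure R).
Local Notation lam := (lebesgue_euclidean R).

(** After a rotation of w to an axis, x . w is a nonzero multiple of the first
coordinate of x. *)
Lemma ae_dotp n (w : euclidean R n.+1) (Q : R -> Prop) : enorm w != 0 ->
  {ae leb, forall s, Q s} -> {ae lam n.+1, forall x, Q (dotp x w)}.
Proof.
move=> w0 [N [mN N0 NQ]].
have [T [isoT [t Tw]]] := rotate_to_axis w.
have t0 : t != 0.
  by rewrite -normr_eq0 -(enorm_axis n t) -Tw (volume_isometry_enorm w isoT).
have [mT dT lT] := isoT.
pose A : set (euclidean R n.+1) := [set y | N (t * (uncons_euclidean y).1 + 0)].
have mA : measurable A.
  rewrite -[X in measurable X]setTI.
  have mf : measurable_fun setT (fun y : euclidean R n.+1 =>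
      t * (uncons_euclidean y).1 + 0 : measurableTypeR R).
    apply: (measurableT_comp (measurable_affine t 0)).
    exact: (measurableT_comp measurable_fst measurable_uncons_euclidean).
  exact: mf.
exists (T @^-1` A); split.
- by rewrite -[X in measurable X]setTI; exact: mT.
- apply: (etrans (lT _ mA)); apply: (etrans (lebesgue_cons_int2 mA)).
  apply: integral0_eq => v _.
  rewrite (_ : [set u | A (cons_euclidean (u, v))] = [set u | N (t * u + 0)]).
    by rewrite lebesgue_affine// N0 mule0.
  by apply/funext => u; rewrite /A /mkset cons_euclideanK.
- move=> x Qx.
  have E : t * (uncons_euclidean (T x)).1 + 0 = dotp x w.
    rewrite -dT Tw; have [u [v ->]] := cons_euclidean_surj (T x).
    by rewrite dotpC dotp_axis cons_euclideanK addr0.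
  by rewrite /preimage /A /mkset E; exact: NQ.
Qed.

(** Fubini's theorem for null sets, in the form needed for properties that hold
almost everywhere on the cylinder. *)
Lemma ae_section d1 d2 (T1 : measurableType d1) (T2 : measurableType d2)
    (m1 : {sigma_finite_measure set T1 -> \bar R})
    (m2 : {sigma_finite_measure set T2 -> \bar R}) (Q : T1 * T2 -> Prop) :
  {ae (m1 \x m2)%E, forall z, Q z} ->
  {ae m2, forall w, {ae m1, forall s, Q (s, w)}}.
Proof.
move=> [N [mN N0 NQ]].
pose f (z : T1 * T2) : \bar R := (\1_N z)%:E.
have mf : measurable_fun setT f by apply/measurable_EFinP; exact: measurable_indic.
have f0 z : (0 <= f z)%E by rewrite lee_fin.
have : (\int[(m1 \x m2)%E]_z f z = 0)%E by rewrite integral_indic// setIT.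
rewrite (fubini_tonelli2 f mf f0) => If.
have mG := measurable_fun_fubini_tonelli_G (m1 := m1) f mf f0.
have : (\int[m2]_w `|fubini_G m1 f w| = 0)%E.
  rewrite -[RHS]If; apply: eq_integral => w _; rewrite gee0_abs//.
  by apply: integral_ge0.
move=> /(ae_eq_integral_abs _ measurableT mG); apply: filterS => w /(_ I) Gw.
exists (ysection N w); split.
- exact: measurable_ysection.
- rewrite -(setIT (ysection N w)) -(integral_indic m1 measurableT (measurable_ysection w mN)) -[RHS]Gw.
  apply: eq_integral => s _; rewrite /f !indicE; congr (_%:R%:E).
  by congr nat_of_bool; apply/idP/idP; rewrite !inE /ysection /= inE.
- by move=> s /= nQ; rewrite ysectionE; apply: NQ.
Qed.

(** The Lebesgue differentiation theorem, with the averages written as integrals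
over the whole line. *)
Lemma cvg_lebesgue_average (f : R -> R) (r : R^nat) :
  leb.-integrable setT (EFin \o f) -> (forall k, 0 < r k) -> r k @[k --> \oo] --> 0 ->
  {ae leb, forall s : R,
    (\int[leb]_t (((2 * r k)^-1 * ((`|t - s| < r k)%R%:R * f t))%:E))%E @[k --> \oo]
      --> (f s)%:E}.
Proof.
move=> intf r0 rcvg; have locf := open_integrable_locally openT intf.
have mf : measurable_fun setT f by apply/measurable_EFinP; exact: measurable_int intf.
pose E (s : R) k : set R := ball s (r k).
have hE s : nicely_shrinking s (E s).
  split; first by move=> k; exact: measurable_ball.
  exists (1, fun k => PosNum (r0 k)); split => //= k; last by rewrite mul1e.
  exact: subset_refl.
move: (lebesgue_differentiation locf); apply: (@filterS _ _ (ae_filter_ringOfSetsType leb)) => s /(nice_lebesgue_differentiation hE locf).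
apply: cvg_trans; apply: near_eq_cvg; apply: nearW => k.
have rk0 : r k != 0 by rewrite gt_eqF.
have -> : lebesgue_measure (E s k) = (2 * r k)%:E.
  by rewrite /E lebesgue_measure_ball ?ltW// mulr_natl.
rewrite inver mulf_eq0 pnatr_eq0 (negbTE rk0)/=.
rewrite integral_mkcond -integralZl//; last first.
  apply: (integrable_mkcond (mu := leb) (EFin \o f) (measurable_ball s (r k))).1.
  by apply: integrableS intf => //; exact: measurable_ball.
apply: eq_integral => t _; rewrite patchE EFinM; congr (_ * _)%E.
case: ifPn => [|]; rewrite ?inE ?notin_setE /E /ball /= distrC.
  by move=> ->; rewrite mul1r.
by move=> /negP/negbTE ->; rewrite mul0r.
Qed.

End almost_everywhere_facts.

Section radon_limit.
Context {R : realType}.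
Local Notation leb := (@lebesgue_measure R).
Local Notation lam := (lebesgue_euclidean R).
Local Notation sph := (surface_measure R).

Lemma ae_unit_sphere n : {ae sph n, forall w, enorm w = 1}.
Proof.
exists (~` [set w | enorm w = 1]); split => //; last exact: surface_measure_carrier.
apply: measurableC; rewrite (_ : [set w | _] = enorm @^-1` [set 1])//.
by rewrite -[X in measurable X]setTI; exact: measurable_enorm.
Qed.

Variables (n : nat) (a b : R) (eps : R^nat).
Variable G : measurableTypeR R * euclidean R n.+1 -> R.
Hypothesis eps0 : forall k, 0 < eps k.
Hypothesis epscvg : eps k @[k --> \oo] --> 0.
Hypothesis mG : measurable_fun setT G.
Hypothesis G2 : (\int[cyl R n.+1]_z (`|G z| ^+ 2)%:E < +oo)%E.
Hypothesis Gsupp :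
  {ae cylinder_measure R n.+1, forall p, ~ (a <= (p.1 : R) <= b) -> G p = 0}.

Let mg : measurable_fun setT (fun z => `|G z|).
Proof. exact: (@measurableT_comp _ _ _ _ _ _ (@Num.norm R R)). Qed.

Let J (s : R) : R := (a <= s <= b)%R%:R.

Let mJ : measurable_fun setT J.
Proof. by apply: measurable_bool_natr; apply: measurable_and; apply: measurable_fun_ler. Qed.

(** The average of |G| over the part of the window around z.1 that lies in
[a, b]. *)
Definition strip_average k (z : measurableTypeR R * euclidean R n.+1) : \bar R :=
  (\int[leb]_t ((2 * eps k)^-1 *
     ((`|t - (z.1 : R)| < eps k)%R%:R * (J t * `|G (t, z.2)|)))%:E)%E.

Let integrand k (q : (measurableTypeR R * euclidean R n.+1) * measurableTypeR R) : \bar R :=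
  ((2 * eps k)^-1 * ((`|(q.2 : R) - (q.1.1 : R)| < eps k)%R%:R * (J q.2 * `|G (q.2, q.1.2)|)))%:E.

Let integrand_ge0 k q : (0 <= integrand k q)%E.
Proof.
by rewrite lee_fin mulr_ge0 ?invr_ge0 ?mulr_ge0// ltW.
Qed.

Let mintegrand k : measurable_fun setT (integrand k).
Proof.
apply/measurable_EFinP; apply: measurable_funM => //; apply: measurable_funM.
  apply: measurable_bool_natr; apply: measurable_fun_ltr => //.
  apply: (@measurableT_comp _ _ _ _ _ _ (@Num.norm R R)) => //.
  apply: measurable_funB; first exact: measurable_snd.
  exact: (measurableT_comp measurable_fst measurable_fst).
apply: measurable_funM.
  exact: (measurableT_comp mJ measurable_snd).
apply: (measurableT_comp mg); apply: measurable_fun_pair; first exact: measurable_snd.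
exact: (measurableT_comp measurable_snd measurable_fst).
Qed.

Lemma measurable_strip_average k : measurable_fun setT (strip_average k).
Proof. exact: (measurable_fun_fubini_tonelli_F (m2 := leb) (integrand k)). Qed.

Lemma strip_average_ge0 k z : (0 <= strip_average k z)%E.
Proof. by apply: integral_ge0 => t _; exact: (integrand_ge0 k (z, t)). Qed.

Lemma integral_band k (x : euclidean R n.+1) :
  (\int[cyl R n.+1]_z (band (eps k) a b (x, z) * `|G z|)%:E =
   \int[sph n.+1]_w strip_average k (dotp x w, w))%E.
Proof.
rewrite integral_cyl.
have mf : measurable_fun setT (fun z => (band (eps k) a b (x, z) * `|G z|)%:E).
  apply/measurable_EFinP; apply: measurable_funM => //.
  by apply: (measurableT_comp (measurable_band (eps k) a b)); exact: pair1_measurable.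
rewrite (fubini_tonelli2 _ mf); last first.
  by move=> z; rewrite lee_fin mulr_ge0// band_ge0// ltW.
apply: eq_integral => w _; apply: eq_integral => t _.
by rewrite /band /= -!mulrA.
Qed.

(** On almost every line G (., w) is square integrable and vanishes outside [a, b],
hence is integrable, and its averages converge almost everywhere; almost every
point x has an inner product x . w at which they do, by [ae_dotp]. *)
Lemma ae_strip_average : {ae sph n.+1, forall w, {ae lam n.+1, forall x,
  strip_average k (dotp x w, w) @[k --> \oo] --> (`|G (dotp x w, w)|)%:E}}.
Proof.
have mg2 : measurable_fun setT (fun z => (`|G z| ^+ 2)%:E).
  by apply/measurable_EFinP; apply: measurable_funX.
have g20 z : (0 <= (`|G z| ^+ 2)%:E)%E by rewrite lee_fin exprn_ge0.
have mI := measurable_fun_fubini_tonelli_G (m1 := leb) _ mg2 g20.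
have int2 : (sph n.+1).-integrable setT (fubini_G leb (fun z => (`|G z| ^+ 2)%:E)).
  apply/integrableP; split; first exact: mI.
  apply: le_lt_trans G2; rewrite integral_cyl (fubini_tonelli2 _ mg2 g20).
  rewrite le_eqVlt; apply/orP; left; apply/eqP; apply: eq_integral => w _.
  by rewrite gee0_abs//; apply: integral_ge0.
have A1 := integrable_ae measurableT int2.
have A2 := ae_section Gsupp.
have A3 := @ae_unit_sphere n.+1.
move: A1 A2 A3; apply: (@filterS3 _ _ (ae_filter_ringOfSetsType (sph n.+1))).
move=> w /(_ I) fin2 sup1 w1.
have w0 : enorm w != 0 by rewrite w1 oner_neq0.
pose f (s : R) := J s * `|G (s, w)|.
have mf : measurable_fun setT f.
  apply: measurable_funM => //; apply: (measurableT_comp mg); exact: pair2_measurable.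
have intf : leb.-integrable setT (EFin \o f).
  apply/integrableP; split; first exact/measurable_EFinP.
  apply: (@le_lt_trans _ _ (\int[leb]_s ((\1_(`[a, b]%classic : set R) s)%:E + (`|G (s, w)| ^+ 2)%:E))%E).
    apply: ge0_le_integral => //.
    - by apply: measurableT_comp => //; exact/measurable_EFinP.
    - apply: emeasurable_funD; first by apply/measurable_EFinP; exact: measurable_indic.
      by apply: (measurableT_comp mg2); exact: pair2_measurable.
    move=> s _; rewrite /= -EFinD lee_fin ger0_norm; last by rewrite mulr_ge0.
    rewrite /f /J indicE mem_setE in_itv /=; move: `|G (s, w)| (normr_ge0 (G (s, w))) => g g0.
    case: (a <= s <= b) => /=; rewrite ?mul0r ?mul1r ?add0r ?exprn_ge0//; nra.
  rewrite ge0_integralD//; last 2 first.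
  - by apply/measurable_EFinP; exact: measurable_indic.
  - by apply: (measurableT_comp mg2); exact: pair2_measurable.
  rewrite integral_indic// setIT lte_add_pinfty//.
    have fJ : (leb `[a, b]%classic < +oo)%E.
      by rewrite lebesgue_measure_itv/=; case: ifP => _; rewrite ?ltry.
    exact: fJ.
  by move: fin2; rewrite ge0_fin_numE// integral_ge0.
apply: (ae_dotp (Q := fun s => strip_average k (s, w) @[k --> \oo] --> (`|G (s, w)|)%:E)) => //.
move: sup1 (cvg_lebesgue_average intf eps0 epscvg); apply: (@filterS2 _ _ (ae_filter_ringOfSetsType leb)).
move=> s Gs; have -> : f s = `|G (s, w)|.
  rewrite /f /J; case: (boolP (a <= s <= b)) => [_|/negP ns]; first by rewrite mul1r.
  by rewrite Gs// normr0 mulr0.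
exact.
Qed.

(** Fatou's lemma on the product of the space of x and the sphere: the
strip averages converge to |G (x . w, w)| almost everywhere there. *)
Lemma radon_limit (f : euclidean R n.+1 -> R) (M : \bar R) :
  measurable_fun setT f -> (forall x, 0 <= f x) ->
  (forall k, (\int[lam n.+1]_x ((f x)%:E *
     \int[cyl R n.+1]_z (band (eps k) a b (x, z) * `|G z|)%:E) <= M)%E) ->
  (\int[lam n.+1]_x ((f x)%:E * \int[sph n.+1]_w (`|G (dotp x w, w)|)%:E) <= M)%E.
Proof.
move=> mf f0 HM.
have mzd : measurable_fun setT
    (fun q : euclidean R n.+1 * euclidean R n.+1 => (dotp q.1 q.2 : measurableTypeR R, q.2)).
  by apply: measurable_fun_pair => //; exact: measurable_dotp.
have mf1 : measurable_fun setT (fun q : euclidean R n.+1 * euclidean R n.+1 => (f q.1)%:E).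
  by apply/measurable_EFinP; exact: (measurableT_comp mf measurable_fst).
pose u (q : euclidean R n.+1 * euclidean R n.+1) : \bar R :=
  ((f q.1)%:E * (`|G (dotp q.1 q.2, q.2)|)%:E)%E.
have u0 q : (0 <= u q)%E by rewrite mule_ge0// lee_fin.
have mu_ : measurable_fun setT u.
  apply: emeasurable_funM => //; apply/measurable_EFinP.
  exact: (measurableT_comp mg mzd).
pose v k (q : euclidean R n.+1 * euclidean R n.+1) : \bar R :=
  ((f q.1)%:E * strip_average k (dotp q.1 q.2, q.2))%E.
have v0 k q : (0 <= v k q)%E by rewrite mule_ge0 ?strip_average_ge0// lee_fin.
have mv k : measurable_fun setT (v k).
  apply: emeasurable_funM => //.
  exact: (measurableT_comp (measurable_strip_average k) mzd).
have ml : measurable_fun setT (fun q => limn_einf (v ^~ q)).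
  apply: (measurableT_comp (@oppe_measurable R setT)).
  by apply: measurable_fun_limn_esup => k; exact: measurableT_comp.
have l0 q : (0 <= limn_einf (v ^~ q))%E.
  rewrite limn_einf_lim; apply: lime_ge; first exact: is_cvg_einfs.
  by apply: nearW => k; apply: le_ereal_inf_tmp => _ [m _ <-].
have fubini1 (h : euclidean R n.+1 * euclidean R n.+1 -> \bar R) :
  measurable_fun setT h -> (forall q, 0 <= h q)%E ->
  (\int[lam n.+1]_x ((f x)%:E * \int[sph n.+1]_w h (x, w)) =
   \int[(lam n.+1 \x sph n.+1)%E]_q ((f q.1)%:E * h q))%E.
  move=> mh h0; rewrite fubini_tonelli1; last 2 first.
  - exact: emeasurable_funM.
  - by move=> q; rewrite mule_ge0// lee_fin.
  apply: eq_integral => x _; rewrite /fubini_F /= ge0_integralZl_EFin//.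
  by apply: (measurableT_comp mh); exact: pair1_measurable.
rewrite (fubini1 (fun q => (`|G (dotp q.1 q.2, q.2)|)%:E)); last 2 first.
- by apply/measurable_EFinP; exact: (measurableT_comp mg mzd).
- by move=> q; rewrite lee_fin.
apply: (@le_trans _ _ (\int[(lam n.+1 \x sph n.+1)%E]_q limn_einf (v ^~ q))%E).
  rewrite (fubini_tonelli2 u)// (fubini_tonelli2 (fun q => limn_einf (v ^~ q)))//.
  apply: ae_ge0_le_integral => //.
  - by move=> w _; apply: integral_ge0.
  - exact: (measurable_fun_fubini_tonelli_G (m1 := lam n.+1) u).
  - by move=> w _; apply: integral_ge0.
  - exact: (measurable_fun_fubini_tonelli_G (m1 := lam n.+1) (fun q => limn_einf (v ^~ q))).
  move: ae_strip_average; apply: (@filterS _ _ (ae_filter_ringOfSetsType (sph n.+1))) => w aw _.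
  have p2 (h : euclidean R n.+1 * euclidean R n.+1 -> \bar R) : measurable_fun setT h ->
      measurable_fun setT (fun x => h (x, w)).
    by move=> mh; apply: (measurableT_comp mh); exact: pair2_measurable.
  apply: ae_ge0_le_integral => //; [exact: p2|exact: (p2 (fun q => limn_einf (v ^~ q)))|].
  move: aw; apply: (@filterS _ _ (ae_filter_ringOfSetsType (lam n.+1))) => x cx _.
  have -> // : limn_einf (v ^~ (x, w)) = u (x, w).
  apply: (cvg_limn_einf_sup _).1; exact: cvgeZl.
apply: (le_trans (fatou _ measurableT mv _)) => //.
rewrite limn_einf_lim; apply: lime_le; first exact: is_cvg_einfs.
apply: nearW => k; apply: (@le_trans _ _ (\int[(lam n.+1 \x sph n.+1)%E]_q v k q)%E).
  by apply: ereal_inf_lbound; exists k => //=.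
apply: le_trans (HM k).
under [leRHS]eq_integral do rewrite integral_band.
rewrite (fubini1 (fun q => strip_average k (dotp q.1 q.2, q.2)))//.
- exact: (measurableT_comp (measurable_strip_average k) mzd).
- by move=> q; exact: strip_average_ge0.
Qed.

End radon_limit.

(** * The estimates *)

Section radon_restriction.
Context {R : realType}.
Local Notation lam := (lebesgue_euclidean R).
Local Notation sph := (surface_measure R).

(** The integral of a nonnegative function is a supremum over the simple functions
below it, so it is monotone for all functions. *)
Lemma ge0_le_integral_nonmeasurable d (T : measurableType d)
    (mu : {measure set T -> \bar R}) (D : set T) (f g : T -> \bar R) :
  (forall x, D x -> 0 <= f x)%E -> (forall x, D x -> f x <= g x)%E ->
  (\int[mu]_(x in D) f x <= \int[mu]_(x in D) g x)%E.
Proof.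
move=> f0 fg; have g0 x : D x -> (0 <= g x)%E.
  by move=> Dx; apply: (le_trans (f0 x Dx)); exact: fg.
rewrite !ge0_integralE//; apply: ereal_sup_le => _ [h hf <-]; exists h => //= x.
by apply: (le_trans (hf x)); apply: lee_restrict.
Qed.

Lemma radon_restriction (e : nat) (E : set (euclidean R e.+1)) (a b A N : R)
    (eps : R^nat) (G : measurableTypeR R * euclidean R e.+1 -> R) :
  (1 <= e)%N -> measurable E -> 0 <= A -> 0 <= N ->
  (forall k, 0 < eps k) -> eps k @[k --> \oo] --> 0 ->
  measurable_fun setT G -> (\int[cyl R e.+1]_z (`|G z| ^+ 2)%:E = N%:E)%E ->
  {ae cylinder_measure R e.+1, forall p, ~ (a <= (p.1 : R) <= b) -> G p = 0} ->
  (forall k x, E x -> forall l, 0 < l ->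
    (lam e.+1 [set y | l%:E < \int[cyl R e.+1]_z
      (band (eps k) a b (x, z) * band (eps k) a b (y, z))%:E] <= (A / l ^+ e.+1)%:E)%E) ->
  (\int[lam e.+1]_(x in E) `|adjoint_radon G x| ^+ (2 * e).+2 <=
    ((4 ^+ e.+1 + 4) * 2 * A * (4 * N) ^+ e.+1)%:E)%E.
Proof.
move=> e1 mE A0 N0 eps0 epscvg mG GN Gsupp wk.
have mzd : measurable_fun setT (fun q : euclidean R e.+1 * euclidean R e.+1 =>
    (dotp q.1 q.2 : measurableTypeR R, q.2)).
  by apply: measurable_fun_pair => //; exact: measurable_dotp.
have mg : measurable_fun setT (fun z => `|G z|).
  exact: (@measurableT_comp _ _ _ _ _ _ (@Num.norm R R)).
pose F (x : euclidean R e.+1) := (\int[sph e.+1]_w (`|G (dotp x w, w)|)%:E)%E.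
have F0 x : (0 <= F x)%E by apply: integral_ge0 => w _; rewrite lee_fin.
have mF : measurable_fun setT F.
  apply: (measurable_fun_fubini_tonelli_F (m2 := sph e.+1)
    (fun q : euclidean R e.+1 * euclidean R e.+1 => (`|G (dotp q.1 q.2, q.2)|)%:E)).
    by apply/measurable_EFinP; exact: (measurableT_comp mg mzd).
  by move=> q; rewrite lee_fin.
have mGx x : measurable_fun setT (fun w => (G (dotp x w, w))%:E).
  apply/measurable_EFinP; apply: (measurableT_comp mG).
  by apply: measurable_fun_pair => //; exact: measurable_dotpl.
apply: (@le_trans _ _ (\int[lam e.+1]_(x in E) F x ^+ (2 * e).+2)%E).
  apply: ge0_le_integral_nonmeasurable => x _; first by rewrite expe_ge0.
  apply: lee_expe2r => //; apply: (le_trans (le_abse_integral _ measurableT (mGx x))).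
  by [].
apply: strong_from_duality => //.
  by rewrite mulr_ge0// mulr_ge0// addr_ge0// exprn_ge0.
move=> phi S c del mphi phi0 phiE phiS c0 del0.
apply: (radon_limit eps0 epscvg mG _ Gsupp).
- by rewrite GN ltry.
- exact: measurable_funX.
- by move=> x; exact: exprn_ge0.
move=> k; have mb := @measurable_band R e.+1 (eps k) a b.
apply: (@tt_star_weak R _ _ _ _ (lam e.+1) (cyl R e.+1) e phi (fun z => `|G z|)
  (@band R e.+1 (eps k) a b) E A S N c del) => //.
- by move=> q; rewrite band_ge0// ltW.
- move=> x y; apply: (le_lt_trans (kernel_le_directions a b x y (eps0 k))).
  rewrite lte_mul_pinfty// ?lee_fin ?invr_ge0 ?mulr_ge0 ?(ltW (eps0 k))//.
  rewrite -ge0_fin_numE//; apply: fin_num_measure; exact: measurable_directions.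
- exact: wk.
- by rewrite GN.
Qed.

Lemma Lnorm2_pow d (T : measurableType d) (mu : {measure set T -> \bar R}) (G : T -> R) (k : nat) :
  G \in Lfun mu 2%:E ->
  measurable_fun setT G /\ exists N : R,
    [/\ 0 <= N, (\int[mu]_z (`|G z| ^+ 2)%:E = N%:E)%E &
      ('N[mu]_2%:E [EFin \o G] ^+ (2 * k) = (N ^+ k)%:E)%E].
Proof.
rewrite inE => /andP[mG]; rewrite inE /= /finite_norm => Gfin.
move: mG; rewrite inE /= => mG; split => //.
have G0 := Lnorm_ge0 mu 2%:E (EFin \o G).
have /fineK Nx : ('N[mu]_2%:E [EFin \o G])%E \is a fin_num by rewrite ge0_fin_numE.
set x := fine _ in Nx; exists (x ^+ 2).
have x0 : 0 <= x by rewrite fine_ge0.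
split; [exact: sqr_ge0| |by rewrite -Nx -EFin_expe exprM].
have n20 : (2 : R) != 0 by rewrite pnatr_eq0.
have := powR_Lnorm mu (EFin \o G) n20.
rewrite -Nx poweR_EFin powR_mulrn// => ->; apply: eq_integral => z _ /=.
by rewrite powR_mulrn.
Qed.
End radon_restriction.

Section estimates.
Context {R : realType}.
Local Notation lam := (lebesgue_euclidean R).

Definition mesh (e0 : R) (k : nat) : R := e0 * k.+1%:R^-1.

Lemma mesh_gt0 e0 k : 0 < e0 -> 0 < mesh e0 k.
Proof. by move=> e00; rewrite mulr_gt0// invr_gt0. Qed.

Lemma mesh_le e0 k : 0 < e0 -> mesh e0 k <= e0.
Proof. by move=> e00; rewrite ler_piMr ?(ltW e00)// invf_le1// ler1n. Qed.

Lemma cvg_mesh e0 : mesh e0 k @[k --> \oo] --> 0.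
Proof. by rewrite -[X in _ --> X](mulr0 e0); apply: cvgMr; exact: cvg_harmonic. Qed.

Definition annulus_constant (m : nat) (kap : R) : R :=
  (4 ^+ m.+4 + 4) * 2 * (12 * 2 ^+ m.+3 * annulus_kernel_constant m kap ^+ m.+4 * 2 ^+ m.+3)
  * 4 ^+ m.+4.

Lemma annulus_constant_gt0 m kap : 0 < kap -> 0 < annulus_constant m kap.
Proof.
move=> k0; rewrite /annulus_constant.
have q0 := annulus_kernel_constant_gt0 m k0.
have [p4 p2] : 0 < 4 ^+ m.+4 :> R /\ 0 < 2 ^+ m.+3 :> R by rewrite !exprn_gt0.
have := exprn_gt0 m.+4 q0; move: (_ ^+ m.+4) (4 ^+ m.+4) (2 ^+ m.+3) p4 p2.
by move=> x y z y0 z0 x0; rewrite !mulr_gt0// addr_gt0.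
Qed.

(** The lower bound for |x| is asked for only when a / 2 <= |x|, because other
points have a null kernel.  So E may be the whole space, with r = a. *)
Lemma annulus_estimate m (kap a b r : R) (E : set (euclidean R m.+4))
    (G : measurableTypeR R * euclidean R m.+4 -> R) :
  0 < a -> a < b -> b <= kap * a -> measurable E ->
  (forall x, E x -> a / 2 <= enorm x -> Num.max r a / 2 <= enorm x) ->
  G \in Lfun (cylinder_measure R m.+4) 2%:E ->
  {ae cylinder_measure R m.+4, forall p, ~ (a <= (p.1 : R) <= b) -> G p = 0} ->
  (\int[lam m.+4]_(x in E) `|adjoint_radon G x| ^+ (2 * m.+4)
   <= (annulus_constant m kap * ((b - a) ^+ m.+4 / (a * Num.max r a ^+ m.+3)))%:E
      * 'N[cylinder_measure R m.+4]_2%:E [EFin \o G] ^+ (2 * m.+4))%E.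
Proof.
move=> a0 ab bk mE HE LG Gsupp.
have [mG [N [N0 GN ->]]] := Lnorm2_pow m.+4 LG.
have kap0 : 0 < kap by rewrite -(pmulr_lgt0 _ a0); lra.
set M := Num.max r a; have M0 : 0 < M by rewrite lt_max a0 orbT.
have ba0 : 0 < b - a by rewrite subr_gt0.
(* eps <= e0 keeps a - eps, b + eps and b - a + 2 eps comparable to a, b, b - a *)
pose e0 := Num.min (a / 2) (b - a).
have e00 : 0 < e0 by rewrite lt_min ba0 divr_gt0.
pose C0 := annulus_kernel_constant m kap.
have C00 : 0 < C0 by exact: annulus_kernel_constant_gt0.
pose A := 12 * 2 ^+ m.+3 * C0 ^+ m.+4 * ((b - a) ^+ m.+4 / (a * (M / 2) ^+ m.+3)).
have c0 : 0 <= 12 * 2 ^+ m.+3 * C0 ^+ m.+4.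
  by apply: mulr_ge0; [apply: mulr_ge0 => //; exact: exprn_ge0|exact/exprn_ge0/ltW].
have A0 : 0 <= A.
  apply: mulr_ge0 => //; apply: divr_ge0; first exact/exprn_ge0/ltW.
  by apply: mulr_ge0; [exact: ltW|apply: exprn_ge0; apply: divr_ge0 => //; exact: ltW].
have wk k x : E x -> forall l, 0 < l ->
    (lam m.+4 [set y | l%:E < \int[cyl R m.+4]_z
      (band (mesh e0 k) a b (x, z) * band (mesh e0 k) a b (y, z))%:E] <= (A / l ^+ m.+4)%:E)%E.
  move=> Ex l l0.
  have em0 := mesh_gt0 k e00; have em1 := mesh_le k e00.
  have ea : mesh e0 k <= a / 2 by apply: (le_trans em1); rewrite ge_min lexx.
  have eb : mesh e0 k <= b - a by apply: (le_trans em1); rewrite ge_min lexx orbT.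
  have [->|[xa]] := weak_type_annulus x a0 ab bk em0 ea eb l0.
    by rewrite lee_fin divr_ge0// exprn_ge0// ltW.
  move=> /le_trans; apply; rewrite lee_fin ler_wpM2r ?invr_ge0 ?exprn_ge0 ?(ltW l0)//.
  have Mx := HE x Ex xa; have M20 : 0 < M / 2 by rewrite divr_gt0.
  have x0 : 0 < enorm x by apply: lt_le_trans Mx.
  rewrite /A ler_wpM2l// ler_wpM2l ?exprn_ge0 ?(ltW ba0)//.
  have p1 : 0 < a * (M / 2) ^+ m.+3 by apply: mulr_gt0 => //; exact: exprn_gt0.
  have p2 : 0 < a * enorm x ^+ m.+3 by apply: mulr_gt0 => //; exact: exprn_gt0.
  rewrite lef_pV2 ?posrE// ler_wpM2l ?(ltW a0)//.
  by apply: lerXn2r => //; rewrite nnegrE ltW.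
have := @radon_restriction R m.+3 E a b A N (mesh e0) G isT mE A0 N0
  (fun k => mesh_gt0 k e00) (cvg_mesh e0) mG GN Gsupp wk.
rewrite (mulnS 2 m.+3) add2n => /le_trans; apply; rewrite -EFinM lee_fin.
rewrite le_eqVlt; apply/orP; left; apply/eqP.
rewrite /annulus_constant -/C0 /A [(4 * N) ^+ _]exprMn [(M / 2) ^+ _]expr_div_n.
have : M ^+ m.+3 != 0 by rewrite gt_eqF// exprn_gt0.
have : 2 ^+ m.+3 != 0 :> R by rewrite gt_eqF// exprn_gt0.
move: (M ^+ m.+3) (2 ^+ m.+3) (4 ^+ m.+4) (N ^+ m.+4) (C0 ^+ m.+4) ((b - a) ^+ m.+4).
move=> M' t q N' C' B t0 M'0; by field; rewrite M'0 t0 gt_eqF.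
Qed.

Definition symmetric_constant (n : nat) : R :=
  (4 ^+ n.+2 + 4) * 2 * (2 * (n.+2%:R * 2 ^+ n.+3)) ^+ n.+2 * 4 ^+ n.+2.

Lemma symmetric_constant_gt0 n : 0 < symmetric_constant n.
Proof.
rewrite /symmetric_constant.
have q0 : 0 < 2 * (n.+2%:R * 2 ^+ n.+3) :> R.
  exact: mulr_gt0.
have p4 : 0 < 4 ^+ n.+2 :> R by rewrite exprn_gt0.
have := exprn_gt0 n.+2 q0; move: ((2 * _) ^+ n.+2) (4 ^+ n.+2) p4.
by move=> x y y0 x0; rewrite !mulr_gt0// addr_gt0.
Qed.

Lemma symmetric_estimate n (b r : R) (G : measurableTypeR R * euclidean R n.+2 -> R) :
  0 < b -> b <= r ->
  G \in Lfun (cylinder_measure R n.+2) 2%:E ->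
  {ae cylinder_measure R n.+2, forall p, ~ (- b <= (p.1 : R) <= b) -> G p = 0} ->
  (\int[lam n.+2]_(x in [set x | (r < enorm x)%R]) `|adjoint_radon G x| ^+ (2 * n.+2)
   <= (symmetric_constant n * (b / r) ^+ n.+1)%:E
      * 'N[cylinder_measure R n.+2]_2%:E [EFin \o G] ^+ (2 * n.+2))%E.
Proof.
move=> b0 br LG Gsupp; have r0 : 0 < r by apply: lt_le_trans br.
have [mG [N [N0 GN ->]]] := Lnorm2_pow n.+2 LG.
set c := (2 * (n.+2%:R * 2 ^+ n.+3)) ^+ n.+2 : R.
have c0 : 0 <= c by rewrite exprn_ge0// mulr_ge0// mulr_ge0// exprn_ge0.
pose A := c * (b / r) ^+ n.+1.
have A0 : 0 <= A by apply: mulr_ge0 => //; apply: exprn_ge0; apply: divr_ge0; exact: ltW.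
have mE : measurable [set x : euclidean R n.+2 | r < enorm x].
  rewrite (_ : [set x | _] = enorm @^-1` `]r, +oo[); last first.
    by apply/seteqP; split=> x /=; rewrite in_itv/= andbT.
  by rewrite -[X in measurable X]setTI; exact: measurable_enorm.
have wk k (x : euclidean R n.+2) : r < enorm x -> forall l, 0 < l ->
    (lam n.+2 [set y | l%:E < \int[cyl R n.+2]_z
      (band (mesh b k) (- b) b (x, z) * band (mesh b k) (- b) b (y, z))%:E] <= (A / l ^+ n.+2)%:E)%E.
  move=> rx l l0; have x0 : 0 < enorm x by apply: lt_trans rx.
  apply: (le_trans (weak_type_symmetric (mesh_gt0 k b0) (mesh_le k b0) x0 l0)).
  rewrite lee_fin ler_wpM2r ?invr_ge0 ?exprn_ge0 ?(ltW l0)// ler_wpM2l//.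
  have bx : b / enorm x <= b / r by rewrite ler_wpM2l ?(ltW b0)// lef_pV2 ?posrE// ltW.
  by apply: lerXn2r => //; rewrite nnegrE divr_ge0// ltW.
have := @radon_restriction R n.+1 _ (- b) b A N (mesh b) G isT mE A0 N0
  (fun k => mesh_gt0 k b0) (cvg_mesh b) mG GN Gsupp wk.
rewrite (mulnS 2 n.+1) add2n => /le_trans; apply; rewrite -EFinM lee_fin.
rewrite le_eqVlt; apply/orP; left; apply/eqP.
rewrite /symmetric_constant -/c /A [(4 * N) ^+ _]exprMn; ring.
Qed.

End estimates.

Theorem theorem1p6 (R : realType) (d : nat) (d_ge4 : (4 <= d)%N) :
  exists C : R, 0 < C /\
  (forall (a b : R) (G : measurableTypeR R * euclidean R d -> R),
    0 < a -> a < b ->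
    b / a < (d%:R ^+ 2 - 2 * d%:R - 1) / (2 * (d%:R - 1)) ->
    G \in Lfun (cylinder_measure R d) 2%:E ->
    {ae cylinder_measure R d, forall p, ~ (a <= (p.1 : R) <= b) -> G p = 0} ->
    (forall r : R, 0 < r ->
      (\int[lebesgue_euclidean R d]_(x in [set x | (r < enorm x)%R])
          `|adjoint_radon G x| ^+ (2 * d)
       <= (C * ((b - a) ^+ d / (a * Num.max r a ^+ d.-1)))%:E
          * 'N[cylinder_measure R d]_2%:E [EFin \o G] ^+ (2 * d))%E) /\
    (\int[lebesgue_euclidean R d]_x `|adjoint_radon G x| ^+ (2 * d)
     <= (C * (b / a - 1) ^+ d)%:E
        * 'N[cylinder_measure R d]_2%:E [EFin \o G] ^+ (2 * d))%E) /\
  (forall (b : R) (G : measurableTypeR R * euclidean R d -> R),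
    0 < b ->
    G \in Lfun (cylinder_measure R d) 2%:E ->
    {ae cylinder_measure R d, forall p, ~ (- b <= (p.1 : R) <= b) -> G p = 0} ->
    forall r : R, b <= r ->
      (\int[lebesgue_euclidean R d]_(x in [set x | (r < enorm x)%R])
          `|adjoint_radon G x| ^+ (2 * d)
       <= (C * (b / r) ^+ d.-1)%:E
          * 'N[cylinder_measure R d]_2%:E [EFin \o G] ^+ (2 * d))%E).
Proof.
have [m -> {d d_ge4}] : exists m, d = m.+4.
  by exists (d - 4)%N; rewrite -addn4 subnK.
pose Ca : R := annulus_constant m m.+4%:R; pose Cb : R := symmetric_constant m.+2.
have Ca0 : 0 < Ca by apply: annulus_constant_gt0; rewrite ltr0n.
have Cb0 : 0 < Cb by exact: symmetric_constant_gt0.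
have N0 (G : measurableTypeR R * euclidean R m.+4 -> R) :
    (0 <= 'N[cylinder_measure R m.+4]_2%:E [EFin \o G] ^+ (2 * m.+4))%E.
  by rewrite expe_ge0// Lnorm_ge0.
exists (Ca + Cb); split; first exact: addr_gt0.
split=> [a b G a0 ab bak LG Gsupp|b G b0 LG Gsupp r br].
  have ba0 : 0 <= b - a by rewrite subr_ge0 ltW.
  have bk : b <= m.+4%:R * a.
    rewrite -ler_pdivrMr//; apply: (le_trans (ltW bak)).
    have d1 : 4 <= m.+4%:R :> R by rewrite (ler_nat R 4).
    by rewrite ler_pdivrMr; nra.
  split=> [r r0|].
    have H := @annulus_estimate R m m.+4%:R a b r [set x | r < enorm x] G a0 ab bk.
    apply: (le_trans (H _ _ LG Gsupp)).
    - rewrite (_ : [set x | _] = enorm @^-1` `]r, +oo[); last first.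
        by apply/seteqP; split=> x /=; rewrite in_itv/= andbT.
      by rewrite -[X in measurable X]setTI; exact: measurable_enorm.
    - move=> x /= rx xa; case: (leP r a) => _ //; lra.
    rewrite lee_wpmul2r// lee_fin ler_wpM2r ?lerDl ?(ltW Cb0)//.
    apply: divr_ge0; first exact: exprn_ge0.
    by apply: mulr_ge0; [exact: ltW|apply: exprn_ge0; rewrite le_max (ltW a0) orbT].
  have H := @annulus_estimate R m m.+4%:R a b a setT G a0 ab bk measurableT.
  apply: (le_trans (H _ LG Gsupp)); first by move=> x _; rewrite maxxx.
  rewrite maxxx lee_wpmul2r// lee_fin.
  have -> : (b / a - 1) ^+ m.+4 = (b - a) ^+ m.+4 / (a * a ^+ m.+3).
    by rewrite -exprS -expr_div_n; congr (_ ^+ _); field; rewrite gt_eqF.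
  rewrite ler_wpM2r ?lerDl ?(ltW Cb0)//; apply: divr_ge0; first exact: exprn_ge0.
  by apply: mulr_ge0; [exact: ltW|exact/exprn_ge0/ltW].
apply: (le_trans (symmetric_estimate b0 br LG Gsupp)).
rewrite lee_wpmul2r// lee_fin ler_wpM2r ?lerDr ?(ltW Ca0)// exprn_ge0// divr_ge0 ?(ltW b0)//.
exact: le_trans (ltW b0) br.
Qed.
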